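(* Let $K\subset S$ be a subset which generates a finite subgroup $W_K$ of $W$. For any $\Omega\in\mathbf{I}_*^K$ we have $A_{d_\Omega}\in\underline{M}^K$.
   Context: $W$ is a Coxeter group with set of simple reflections $S$, length function $l:W\to\mathbf{N}$ and Bruhat order $\le$. $w\mapsto w^*$ is an automorphism of $W$ with square $1$ which leaves $S$ stable. $\mathbf{I}_*=\{w\in W : (w^* )^{-1}=w\}$. $u$ is an indeterminate and $\mathcal{A}=\mathbf{Z}[u,u^{-1}]$. $\mathfrak{H}$ is the free $\mathcal{A}$-module with basis $(T_w)_{w\in W}$ with the unique $\mathcal{A}$-algebra structure with unit $T_1$ such that $T_wT_{w'}=T_{ww'}$ if $l(ww')=l(w)+l(w')$, and $(T_s+1)(T_s-u^2)=0$ for all $s\in S$. $\overline{\phantom{x}}:\mathfrak{H}\to\mathfrak{H}$ is the unique ring involution such that $\overline{u^nT_x}=u^{-n}T_{x^{-1}}^{-1}$ for $x\in W$, $n\in\mathbf{Z}$. $M$ is the free $\mathcal{A}$-module with basis $\{a_w : w\in\mathbf{I}_*\}$, with its unique $\mathfrak{H}$-module structure such that for $s\in S$, $w\in\mathbf{I}_*$: $T_s a_w = u a_w + (u+1)a_{sw}$ if $sw = ws^* > w$; $T_s a_w = (u^2-u-1)a_w + (u^2-u)a_{sw}$ if $sw = ws^* < w$; $T_s a_w = a_{sws^*}$ if $sw\ne ws^*$, $sw > w$; $T_s a_w = (u^2-1)a_w + u^2 a_{sws^*}$ if $sw\ne ws^*$, $sw < w$. $\overline{\phantom{x}}:M\to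 M$ is the unique $\mathbf{Z}$-linear map such that $\overline{hm}=\overline{h}\,\overline{m}$ for $h\in\mathfrak{H}$, $m\in M$ and $\overline{a_1}=a_1$. $v$ is an indeterminate, $\underline{\mathcal{A}}=\mathbf{Z}[v,v^{-1}]\supset\mathcal{A}$ via $u=v^2$. $\underline{M}=\underline{\mathcal{A}}\otimes_{\mathcal{A}}M$, and $\overline{\phantom{x}}$ is extended to $\underline{M}$ by $\overline{v^nm}=v^{-n}\overline{m}$ for $m\in M$, $n\in\mathbf{Z}$. For $w\in\mathbf{I}_*$, $A_w=v^{-l(w)}\sum_{y\in\mathbf{I}_*;\,y\le w}P^\sigma_{y,w}a_y\in\underline{M}$ (with $P^\sigma_{y,w}\in\mathbf{Z}[u]$) is the unique element of this form such that $\overline{A_w}=A_w$, $P^\sigma_{w,w}=1$ and $\deg P^\sigma_{y,w}\le(l(w)-l(y)-1)/2$ for all $y\in\mathbf{I}_*$, $y<w$. $K^*$ is the image of $K$ under $*$. For a $(W_K,W_{K^*})$-double coset $\Omega$ in $W$, $d_\Omega$ denotes its unique element of maximal length. $\mathbf{I}_*^K$ is the set of $(W_K,W_{K^*})$-double cosets $\Omega$ in $W$ that are stable under $w\mapsto (w^* )^{-1}$ (equivalently, $d_\Omega\in\mathbf{I}_*$). For $\Omega\in\mathbf{I}_*^K$ set $a_\Omega=\sum_{w\in\mathbf{I}_*\cap\Omega}a_w$; $\underline{M}^K$ is the $\underline{\mathcal{A}}$-submodule of $\underline{M}$ spanned by the elements $a_\Omega$ ($\Omega\in\mathbf{I}_*^K$).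 *)

(* Defs.v *)
From HB Require Import structures.
From mathcomp Require Import all_boot all_order all_algebra.
From mathcomp Require Import finmap.
From mathcomp Require Import boolp classical_sets functions cardinality fsbigop.

Set Implicit Arguments.
Unset Strict Implicit.
Unset Printing Implicit Defensive.

Import GRing.Theory.
Local Open Scope classical_set_scope.
Local Open Scope ring_scope.

(** [groupType] is the type of arbitrary, possibly infinite, groups; no
    finiteness is imposed on [W] or [S]. *)

Definition is_subgroup (W : groupType) (B : set W) : Prop :=
  [/\ B 1%g, (forall x y, B x -> B y -> B (x * y)%g)
    & forall x, B x -> B (x^-1)%g].

Definition gen (W : groupType) (K : set W) : set W :=
  smallest (@is_subgroup W) K.

(** The last clause is the universal property of the presentation with
    generators [S] and relations [(s t)^m(s,t) = 1], where [m(s,t)] is the order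
    of [s t] in [W] (no relation when that order is infinite). *)
Definition coxeter_system (W : groupType) (S : set W) : Prop :=
  [/\ (forall s, S s -> s <> 1%g /\ (s * s)%g = 1%g),
      gen S = setT
    & forall (G : groupType) (f : W -> G),
        (forall s t n, S s -> S t ->
           ((s * t) ^+ n)%g = 1%g -> ((f s * f t) ^+ n)%g = 1%g) ->
        exists phi : W -> G,
          {morph phi : x y / (x * y)%g} /\ (forall s, S s -> phi s = f s)].

Definition expression (W : groupType) (S : set W) (w : W) (r : seq W) : Prop :=
  (forall s, s \in r -> S s) /\ w = (\prod_(s <- r) s)%g.

Definition len (W : groupType) (S : set W) (w : W) : nat :=
  xget 0%N [set n | (exists r, expression S w r /\ size r = n)
                    /\ (forall r, expression S w r -> (n <= size r)%N)].

Definition reflection (W : groupType) (S : set W) : set W :=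
  [set t | exists s x, S s /\ t = (x * s * x^-1)%g].

Inductive bruhat_le (W : groupType) (S : set W) (y : W) : W -> Prop :=
| bruhat_refl : bruhat_le S y y
| bruhat_step w t : bruhat_le S y w -> reflection S t ->
    (len S w < len S (w * t)%g)%N -> bruhat_le S y (w * t)%g.

Definition bruhat_lt (W : groupType) (S : set W) (y w : W) : Prop :=
  bruhat_le S y w /\ y <> w.

Definition diagram_involution (W : groupType) (S : set W) (star : W -> W) : Prop :=
  [/\ {morph star : x y / (x * y)%g}, involutive star
    & forall s, S s -> S (star s)].

Definition Istar (W : groupType) (star : W -> W) : set W :=
  [set w | ((star w)^-1)%g = w].

(** [sc] is the scalar action; it is a parameter because it is
    sometimes not the [*:%R] of the ambient structure.  Only the values of the
    family [b] on the index set [D] matter. *)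

Definition basis_on (R : nzRingType) (V : zmodType) (sc : R -> V -> V)
    (J : choiceType) (D : set J) (b : J -> V) : Prop :=
  forall x : V, exists! c : J -> R,
    [/\ finite_set [set i | c i <> 0], [set i | c i <> 0] `<=` D
      & x = \sum_(i \in D) sc (c i) (b i)].

Definition span (R : nzRingType) (V : lmodType R) (B : set V) : set V :=
  [set x | exists (n : nat) (c : 'I_n -> R) (b : 'I_n -> V),
     (forall i, B (b i)) /\ x = \sum_(i < n) c i *: b i].

(** [R] is the Laurent polynomial ring [Z[x, x^-1]]. *)
Definition laurent_ring (R : comUnitRingType) (x : R) : Prop :=
  x \is a GRing.unit /\
  basis_on (fun (k : int) (r : R) => r *~ k) [set: int] (fun n : int => x ^ n).

(** The action of the ground ring of an algebra [H] on an [H]-module. *)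
Definition bscale (A : comUnitRingType) (H : unitAlgType A) (M : lmodType H)
  (c : A) (m : M) : M := (c%:A : H) *: m.

(** [j : M -> N] is the canonical map from an [A]-module [M] (scalar action
    [sc]) to its scalar extension along [iota : A -> B]. *)
Definition scalar_extension (A B : comUnitRingType) (iota : A -> B)
    (M : zmodType) (sc : A -> M -> M) (N : lmodType B) (j : M -> N) : Prop :=
  (forall c m, j (sc c m) = iota c *: j m) /\
  forall (N' : lmodType B) (f : {additive M -> N'}),
    (forall c m, f (sc c m) = iota c *: f m) ->
    exists g : {linear N -> N'},
      (forall m, g (j m) = f m) /\
      (forall g' : {linear N -> N'}, (forall m, g' (j m) = f m) -> g' =1 g).

(** In a [unitAlgType], [^-1] is
    the two-sided inverse whenever one exists. *)

Definition hecke_algebra (W : groupType) (S : set W) (A : comUnitRingType)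
    (u : A) (H : unitAlgType A) (T : W -> H) : Prop :=
  [/\ basis_on (fun (c : A) (h : H) => c *: h) [set: W] T,
      T 1%g = 1,
      (forall w w', len S (w * w')%g = (len S w + len S w')%N ->
         T w * T w' = T (w * w')%g)
    & forall s, S s -> (T s + 1) * (T s - (u ^+ 2)%:A) = 0].

Definition hecke_bar (W : groupType) (A : comUnitRingType) (u : A)
    (H : unitAlgType A) (T : W -> H) (barH : H -> H) : Prop :=
  involutive barH /\
  forall (n : int) (x : W), barH (u ^ n *: T x) = u ^ (- n) *: (T (x^-1)%g)^-1.

(** The family [a] is
    indexed by all of [W] for convenience; its other values are irrelevant. *)

Definition involution_module (W : groupType) (S : set W) (star : W -> W)
    (A : comUnitRingType) (u : A) (H : unitAlgType A) (T : W -> H)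
    (M : lmodType H) (a : W -> M) : Prop :=
  basis_on (@bscale A H M) (Istar star) a /\
  forall s w, S s -> Istar star w ->
  [/\ (s * w = w * star s)%g -> bruhat_lt S w (s * w)%g ->
        T s *: a w = bscale u (a w) + bscale (u + 1) (a (s * w)%g),
      (s * w = w * star s)%g -> bruhat_lt S (s * w)%g w ->
        T s *: a w = bscale (u ^+ 2 - u - 1) (a w)
                     + bscale (u ^+ 2 - u) (a (s * w)%g),
      (s * w <> w * star s)%g -> bruhat_lt S w (s * w)%g ->
        T s *: a w = a (s * w * star s)%g
    & (s * w <> w * star s)%g -> bruhat_lt S (s * w)%g w ->
        T s *: a w = bscale (u ^+ 2 - 1) (a w)
                     + bscale (u ^+ 2) (a (s * w * star s)%g)].

Definition module_bar (W : groupType) (A : comUnitRingType) (H : unitAlgType A)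
    (M : lmodType H) (a : W -> M) (barH : H -> H) (barM : M -> M) : Prop :=
  (forall h m, barM (h *: m) = barH h *: barM m) /\ barM (a 1%g) = a 1%g.

Definition extended_bar (M : zmodType) (B : comUnitRingType) (v : B)
    (N : lmodType B) (j : M -> N) (barM : M -> M) (barN : N -> N) : Prop :=
  forall (n : int) (m : M), barN (v ^ n *: j m) = v ^ (- n) *: j (barM m).

(** [A_w = v^(-l(w)) sum_(y in Istar, y <= w) P_(y,w) a_y], the polynomials
    [P y w] in [Z[u]] being represented in [{poly int}].  Only finitely many
    [y] satisfy [y <= w], so the finitely supported sum is the genuine one. *)
Definition kl_element (W : groupType) (S : set W) (star : W -> W)
    (A B : comUnitRingType) (u : A) (v : B) (iota : A -> B)
    (M : zmodType) (a : W -> M) (N : lmodType B) (j : M -> N)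
    (P : W -> W -> {poly int}) (w : W) : N :=
  v ^- len S w *:
    \sum_(y \in [set y | Istar star y /\ bruhat_le S y w])
      iota ((map_poly intr (P y w)).[u]) *: j (a y).

(** The degree bound is [deg P_(y,w) <= (l(w) - l(y) - 1) / 2] cleared of the
    division and of subtractions.  For [P y w = 0] it reads [l(y) + 1 <= l(w)],
    which holds whenever [y < w]. *)
Definition kl_family (W : groupType) (S : set W) (star : W -> W)
    (A B : comUnitRingType) (u : A) (v : B) (iota : A -> B)
    (M : zmodType) (a : W -> M) (N : lmodType B) (j : M -> N) (barN : N -> N)
    (P : W -> W -> {poly int}) : Prop :=
  forall w, Istar star w ->
  [/\ barN (kl_element S star u v iota a j P w)
        = kl_element S star u v iota a j P w,
      P w w = 1
    & forall y, Istar star y -> bruhat_lt S y w ->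
        (2 * (size (P y w)).-1 + len S y + 1 <= len S w)%N].

Definition double_coset (W : groupType) (star : W -> W) (K : set W)
    (Om : set W) : Prop :=
  exists x : W, Om = [set w | exists p q,
    [/\ gen K p, gen (star @` K) q & w = (p * x * q)%g]].

Definition IstarK (W : groupType) (star : W -> W) (K : set W) : set (set W) :=
  [set Om | double_coset star K Om /\
            forall w, Om w -> Om ((star w)^-1)%g].

(** When [gen K] is finite and [Om] is a double coset, the element of maximal
    length is unique, so the choice made by [xget] is immaterial. *)
Definition dmax (W : groupType) (S : set W) (Om : set W) : W :=
  xget 1%g [set d | Om d /\ forall x, Om x -> (len S x <= len S d)%N].

Definition a_coset (W : groupType) (star : W -> W) (M : zmodType) (a : W -> M)
    (Om : set W) : M :=
  \sum_(w \in Istar star `&` Om) a w.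

(** The submodule spanned by the elements [1 (x) a_Om], [Om] in [IstarK]. *)
Definition MK (W : groupType) (star : W -> W) (K : set W) (M : zmodType)
    (a : W -> M) (B : comUnitRingType) (N : lmodType B) (j : M -> N) : set N :=
  span [set j (a_coset star a Om) | Om in IstarK star K].

(* Main.v *)
Require Import Defs.
From HB Require Import structures.
From mathcomp Require Import all_boot all_order all_algebra.
From mathcomp Require Import finmap.
From mathcomp Require Import zify ring.
From mathcomp Require Import boolp classical_sets functions cardinality fsbigop.

Set Implicit Arguments.
Unset Strict Implicit.
Unset Printing Implicit Defensive.

Import Order.TTheory GRing.Theory Num.Theory.
Local Open Scope classical_set_scope.
Local Open Scope ring_scope.

(** Lusztig's [T_s] acts on [M] with eigenvalues [u^2] and [-1], and the [a_Om]
    span the common [u^2]-eigenspace of the [T_s], [s] in [K]: an element lies in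
    it when its coefficients agree on [w] and on its neighbour [s w] or
    [s w s^*].  Every twisted involution of [Om] climbs to
    [d = d_Om] through such neighbours, because an element of [Om] having all
    descents dominates [Om] in the Bruhat order.  So it is enough that
    [X = (T_s - u^2) A_w] vanishes whenever [s w < w].

    The bar involution is unitriangular on the [v^(-l(y)) a_y], because the [A_y]
    are bar invariant, and [X] satisfies [bar X = v^-4 X].  For [z] of maximal
    length in its support, the coefficient of [a_z] in [X] is therefore symmetric
    in [v] about the degree [2 - l(z)].  This [z] must have [s] as a descent, and
    then the degree bounds on [P_(y,w)] confine the coefficient to degrees
    [< 2 - l(z)], or make it [(v^2 + 1) g] with [g] of degree [<= - l(z)]; both
    force it to be zero. *)

(** * Coxeter groups: strong exchange and the Bruhat order *)

(** The semidirect product of [W] with the [bool]-valued functions on [W], on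
    which [W] acts by conjugation.  The homomorphism sending a simple reflection
    [s] to [(s, indicator of s)] counts inversions modulo 2. *)
Definition signed_ext (W : groupType) : Type := (W * (W -> bool))%type.

Section SignedExt.
Local Open Scope group_scope.
Variable W : groupType.
Implicit Types x y z : signed_ext W.

HB.instance Definition _ := gen_eqMixin (signed_ext W).
HB.instance Definition _ := gen_choiceMixin (signed_ext W).

Definition sx_one : signed_ext W := (1, fun _ => false).
Definition sx_mul x y : signed_ext W :=
  (x.1 * y.1, fun t => x.2 t (+) y.2 (x.1^-1 * t * x.1)).
Definition sx_inv x : signed_ext W := (x.1^-1, fun t => x.2 (x.1 * t * x.1^-1)).

Lemma sx_mulgA : associative sx_mul.
Proof.
move=> x y z; rewrite /sx_mul /= mulgA; congr (_, _); apply/funext => t.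
by rewrite invgM !mulgA addbA.
Qed.

Lemma sx_mul1g : left_id sx_one sx_mul.
Proof.
case=> x X; rewrite /sx_mul /= mul1g; congr (_, _); apply/funext => t.
by rewrite invg1 mul1g mulg1.
Qed.

Lemma sx_mulg1 : right_id sx_one sx_mul.
Proof.
by case=> x X; rewrite /sx_mul /= mulg1; congr (_, _); apply/funext => t; rewrite addbF.
Qed.

Lemma sx_mulVg : left_inverse sx_one sx_inv sx_mul.
Proof.
case=> x X; rewrite /sx_mul /sx_one /sx_inv /= mulVg; congr (_, _).
by apply/funext => t; rewrite invgK addbb.
Qed.

Lemma sx_mulgV : right_inverse sx_one sx_inv sx_mul.
Proof.
case=> x X; rewrite /sx_mul /sx_one /sx_inv /= mulgV; congr (_, _).
by apply/funext => t; rewrite !mulgA mulgV mul1g -!mulgA mulgV mulg1 addbb.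
Qed.

HB.instance Definition _ :=
  isGroup.Build (signed_ext W) sx_mulgA sx_mul1g sx_mulg1 sx_mulVg sx_mulgV.

End SignedExt.

Lemma sx_mulE (W : groupType) (x y : signed_ext W) :
  (x * y)%g = (x.1 * y.1, fun t => x.2 t (+) y.2 (x.1^-1 * t * x.1))%g.
Proof. by []. Qed.

(** * Words, length and the inversion homomorphism *)

Section Words.
Local Open Scope group_scope.
Variables (W : groupType) (S : set W).
Hypothesis hW : coxeter_system S.

Lemma eq_conjV (x y z : W) : (x^-1 * z * x == y) = (z == x * y * x^-1).
Proof.
by apply/eqP/eqP => [<-|->]; rewrite !mulgA ?(mulgV, mulVg) mul1g ?mulgK ?mulgVK.
Qed.

Lemma gen_ind (K : set W) (Q : W -> Prop) :
  Q 1 -> (forall x y, Q x -> Q y -> Q (x * y)) -> (forall x, Q x -> Q (x^-1)) ->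
  (forall s, K s -> Q s) -> forall x, gen K x -> Q x.
Proof.
by move=> Q1 QM QV QK x; apply; split.
Qed.

Lemma gen1 (K : set W) : gen K 1.
Proof. by move=> B [[]]. Qed.

Lemma genM (K : set W) x y : gen K x -> gen K y -> gen K (x * y).
Proof. by move=> gx gy B hB; have [[_ BM _] _] := hB; apply: BM; [exact: gx|exact: gy]. Qed.

Lemma genV (K : set W) x : gen K x -> gen K (x^-1).
Proof. by move=> gx B hB; have [[_ _ BV] _] := hB; apply: BV; exact: gx. Qed.

Lemma mem_gen (K : set W) x : K x -> gen K x.
Proof. by move=> Kx B [_ KB]; exact: KB. Qed.

Lemma simple_ss s : S s -> s * s = 1.
Proof. by case: hW => h _ _ /h []. Qed.

Lemma simpleV s : S s -> s^-1 = s.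
Proof. by case: hW => h _ _ /h [_ /mulg1_eq]. Qed.

Lemma simpleK s x : S s -> s * (s * x) = x.
Proof. by move=> Ss; rewrite mulgA simple_ss // mul1g. Qed.

Lemma simpleKr s x : S s -> x * s * s = x.
Proof. by move=> Ss; rewrite -mulgA simple_ss // mulg1. Qed.

Lemma expression_exists w : exists r, expression S w r.
Proof.
have : gen S w by case: hW => _ -> _.
move: w; apply: gen_ind => [|x y [r [rS ->]] [r' [rS' ->]]|x [r [rS ->]]|s Ss].
- by exists [::]; split => //; rewrite big_nil.
- exists (r ++ r'); split; last by rewrite big_cat.
  by move=> s; rewrite mem_cat => /orP[/rS|/rS'].
- elim: r rS => [|s r IH] rS; first by exists [::]; split => //; rewrite big_nil invg1.
  have [|r' [r'S E]] := IH; first by move=> t tr; apply: rS; rewrite inE tr orbT.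
  exists (rcons r' s); split.
    by move=> t; rewrite mem_rcons inE => /orP[/eqP->|/r'S//]; apply: rS; rewrite inE eqxx.
  rewrite big_cons invgM E simpleV; last by apply: rS; rewrite inE eqxx.
  by rewrite -cats1 big_cat big_seq1.
- by exists [:: s]; split => [t|]; rewrite ?big_seq1 // inE => /eqP->.
Qed.

(** The set inside [len] is inhabited by the minimal size of an expression, so [xget] returns that
    minimum. *)
Lemma lenP w : (exists r, expression S w r /\ size r = len S w)
  /\ (forall r, expression S w r -> (len S w <= size r)%N).
Proof.
have /cid2[] : exists2 n : nat, (exists r, expression S w r /\ size r = n)
                    & (forall r, expression S w r -> (n <= size r)%N).
  have [r0 hr0] := expression_exists w.
  have ex : exists n, `[< exists r, expression S w r /\ size r = n >].
    by exists (size r0); apply/asboolP; exists r0.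
  exists (ex_minn ex); case: ex_minnP => m /asboolP // _ mmin r hr.
  by apply: mmin; apply/asboolP; exists r.
move=> n h1 h2; rewrite /len.
by case: xgetP => [m _ [? ?]|/(_ n)/=[]].
Qed.

Lemma len_le w r : expression S w r -> (len S w <= size r)%N.
Proof. by have [_] := lenP w; apply. Qed.

Lemma reduced_exists w : exists r, expression S w r /\ size r = len S w.
Proof. by have [] := lenP w. Qed.

Lemma expression_cons s w r : S s -> expression S w r -> expression S (s * w) (s :: r).
Proof.
move=> Ss [rS ->]; split; last by rewrite big_cons.
by move=> t; rewrite inE => /orP[/eqP->|/rS].
Qed.

Lemma len_simple_le s w : S s -> (len S (s * w) <= (len S w).+1)%N.
Proof.
move=> Ss; have [r [hr <-]] := reduced_exists w.
exact: (len_le (expression_cons Ss hr)).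
Qed.

(** [inv_word r t] is the parity of the number of [i] with
    [t = s_1 .. s_i .. s_1], for [r = s_1 .. s_k]. *)
Fixpoint inv_word (r : seq W) (t : W) : bool :=
  if r is s :: r' then (t == s) (+) inv_word r' (s^-1 * t * s) else false.

Definition sx_gen (s : W) : signed_ext W := (s, fun t => t == s).

Lemma sx_gen_word r :
  \prod_(s <- r) sx_gen s = (\prod_(s <- r) s, inv_word r) :> signed_ext W.
Proof.
by elim: r => [|s r IH]; rewrite ?big_nil // !big_cons IH.
Qed.

(* Each reflection [(s t)^i s] occurs for both [i] and [i + n] among the
   reflections of the word [(s t)^n] when [(s t)^n = 1]. *)
Lemma sx_gen_rel s t n : S s -> S t -> (s * t) ^+ n = 1 ->
  (sx_gen s * sx_gen t : signed_ext W) ^+ n = 1.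
Proof.
move=> Ss St stn.
have E (k : nat) : (sx_gen s * sx_gen t : signed_ext W) ^+ k =
  ((s * t) ^+ k, fun z : W => odd (\sum_(0 <= i < k.*2) (z == (s * t) ^+ i * s)%g)).
  elim: k => [|k IH].
    by rewrite !expg0; congr (_, _); apply/funext => z; rewrite big_geq.
  rewrite !expgSr IH !sx_mulE /=; congr (_, _).
  apply/funext => z /=.
  rewrite doubleS !big_nat_recr //= !oddD !oddb -!addbA; congr (_ (+) _).
  have J (i : nat) : (s * t) ^+ i * s = s * (t * s) ^+ i.
    elim: i => [|i IHi]; first by rewrite !expg0 mul1g mulg1.
    by rewrite expgS -mulgA IHi expgS !mulgA.
  have JV (i : nat) : ((s * t) ^+ i)^-1 = (t * s) ^+ i.
    by rewrite -expVgn invgM !simpleV.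
  rewrite !eq_conjV JV (simpleV Ss) -[in RHS]addnn; congr (_ (+) _).
    by rewrite -mulgA -J mulgA -expgnDr.
  rewrite -addSn expgnDr expgSr -[in RHS]mulgA J.
  by rewrite !mulgA.
rewrite E stn; congr (_, _); apply/funext => z.
rewrite -addnn (big_cat_nat (n := n)) ?leq_addr //=.
have -> : (\sum_(n <= i < n + n) (z == ((s * t) ^+ i * s)%g) =
           \sum_(0 <= i < n) (z == ((s * t) ^+ i * s)%g))%N.
  rewrite -{1}[n]add0n big_addn addnK; apply: eq_bigr => i _.
  by rewrite expgnDr stn mulg1.
by rewrite oddD addbb.
Qed.

(** The universal property gives mere existence; [cid] turns the homomorphism into data, so that
    [inverts] can be a function. *)
Definition sx_hom : {phi : W -> signed_ext W |
  {morph phi : x y / x * y} /\ (forall s, S s -> phi s = sx_gen s)}.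
Proof.
apply: cid; case: hW => _ _; apply => s t n; exact: sx_gen_rel.
Qed.

(** For a reflection [t], this says that [l(tw) < l(w)]. *)
Definition inverts (w t : W) : bool := (sval sx_hom w).2 t.

(** Since the homomorphism does not see the chosen word, the parity [inv_word r] depends only on the
    product of [r]. *)
Lemma sx_homE w r : expression S w r -> sval sx_hom w = (w, inv_word r).
Proof.
case: sx_hom => phi [phiM phiS] /= [rS ->].
have phi1 : phi 1 = 1.
  by apply: (@mulgI _ (phi 1)); rewrite mulg1 -phiM mulg1.
rewrite -sx_gen_word; elim: r rS => [|s r IH] rS; first by rewrite !big_nil.
rewrite !big_cons phiM phiS ?IH // => [t tr|]; apply: rS; rewrite inE ?eqxx //.
by rewrite tr orbT.
Qed.

Lemma inverts_word w r t : expression S w r -> inverts w t = inv_word r t.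
Proof. by move=> hr; rewrite /inverts (sx_homE hr). Qed.

(** Cocycle rule, read off the multiplication of the semidirect product. *)
Lemma invertsM x y t : inverts (x * y) t = inverts x t (+) inverts y (x^-1 * t * x).
Proof.
rewrite /inverts; have [rx hx] := expression_exists x.
have := sx_homE hx; case: sx_hom => phi [phiM _] /= E.
by rewrite phiM E.
Qed.

Lemma inverts1 t : inverts 1 t = false.
Proof.
by rewrite (@inverts_word _ [::]) //; split => //; rewrite big_nil.
Qed.

Lemma inverts_simple s t : S s -> inverts s t = (t == s).
Proof.
move=> Ss; rewrite (@inverts_word _ [:: s]) /= ?addbF //; split.
  by move=> x; rewrite inE => /eqP->.
by rewrite big_seq1.
Qed.

(** * Reflections and strong exchange *)

Lemma reflection_simple s : S s -> reflection S s.
Proof. by move=> Ss; exists s, 1; rewrite mul1g invg1 mulg1. Qed.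

Lemma reflectionJ t x : reflection S t -> reflection S (x * t * x^-1).
Proof.
by move=> [s [y [Ss ->]]]; exists s, (x * y); rewrite invgM !mulgA.
Qed.

Lemma reflection_tt t : reflection S t -> t * t = 1.
Proof.
move=> [s [x [Ss ->]]].
by rewrite !mulgA mulgVK -[x * s * s]mulgA simple_ss // mulg1 mulgV.
Qed.

Lemma reflectionV t : reflection S t -> t^-1 = t.
Proof. by move=> /reflection_tt/mulg1_eq. Qed.

(** Write [t = x s x^-1] and apply the cocycle rule: the contributions of [x] and [x^-1] cancel, and
    [s] inverts itself. *)
Lemma inverts_self t : reflection S t -> inverts t t.
Proof.
move=> [s [x [Ss Et]]].
have tx : x^-1 * t * x = s by rewrite Et !mulgA mulVg mul1g mulgVK.
rewrite {1}Et -mulgA invertsM tx invertsM (inverts_simple _ Ss) eqxx.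
rewrite mulVg mul1g.
have := invertsM x x^-1 t; rewrite mulgV inverts1 tx.
by case: (inverts x t); case: (inverts _ _).
Qed.

(** An odd parity makes [t] one of the reflections [s_1 .. s_i .. s_1] of the word, and multiplying
    by it on the left deletes [s_i]. *)
Lemma inverts_delete w r t : expression S w r -> inverts w t ->
  exists r', [/\ subseq r' r, (size r').+1 = size r & expression S (t * w) r'].
Proof.
move=> hr; rewrite (inverts_word _ hr).
elim: r w t hr => [|s r IH] w t //= [rS ->].
have Ss : S s by apply: rS; rewrite inE eqxx.
have hr : forall x, x \in r -> S x by move=> x xr; apply: rS; rewrite inE xr orbT.
rewrite big_cons; have [-> _|_ /=] := eqVneq t s.
  exists r; split; [exact: (subseq_cons r s)|by []|].
  by rewrite simpleK.
case/(IH (\prod_(x <- r) x)); first by split.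
move=> r' [sub sz hr']; exists (s :: r'); split; rewrite /= ?eqxx ?sz //.
have -> : t * (s * \prod_(j <- r) j) = s * (s^-1 * t * s * \prod_(j <- r) j).
  by rewrite !mulgA mulgV mul1g.
exact: expression_cons.
Qed.

Lemma inverts_len_lt w t : inverts w t -> (len S (t * w) < len S w)%N.
Proof.
have [r [hr <-]] := reduced_exists w.
by move=> /(inverts_delete hr)[r' [_ <- /len_le]].
Qed.

(** For the converse: if [t] does not invert [w], the cocycle rule and [inverts_self] show that it
    inverts [t w], so [w] is shorter than [t w]. *)
Lemma inverts_len w t : reflection S t ->
  inverts w t = (len S (t * w) < len S w)%N.
Proof.
move=> rt; apply/idP/idP => [/inverts_len_lt//|lt].
case: (boolP (inverts w t)) => // ninv.
have : inverts (t * w) t.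
  by rewrite invertsM inverts_self // mulVg mul1g (negbTE ninv).
move/inverts_len_lt; rewrite mulgA reflection_tt // mul1g.
by rewrite ltnNge (ltnW lt).
Qed.

Lemma reflection_len_neq w t : reflection S t -> len S (t * w) != len S w.
Proof.
move=> rt; apply/eqP => E.
have := inverts_len w rt; rewrite E ltnn => ninv.
have := inverts_len (t * w) rt.
rewrite mulgA reflection_tt // mul1g E ltnn.
by rewrite invertsM inverts_self // mulVg mul1g ninv.
Qed.

Lemma strong_exchange w r t : reflection S t -> expression S w r ->
  (len S (t * w) < len S w)%N ->
  exists r', [/\ subseq r' r, (size r').+1 = size r & expression S (t * w) r'].
Proof. by move=> rt hr; rewrite -inverts_len // => /(inverts_delete hr). Qed.

Lemma expression_rev w r : expression S w r -> expression S w^-1 (rev r).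
Proof.
move=> [rS ->]; split=> [s|]; first by rewrite mem_rev => /rS.
elim: r rS => [|s r IH] rS; first by rewrite /rev /= !big_nil invg1.
rewrite big_cons invgM IH => [|t tr]; last by apply: rS; rewrite inE tr orbT.
by rewrite rev_cons -cats1 big_cat big_seq1 simpleV //; apply: rS; rewrite inE eqxx.
Qed.

Lemma lenV w : len S w^-1 = len S w.
Proof.
have H x : (len S x^-1 <= len S x)%N.
  have [r [hr <-]] := reduced_exists x.
  by rewrite -(size_rev r); exact: len_le (expression_rev hr).
by apply/eqP; rewrite eqn_leq H -{1}(invgK w) H.
Qed.

Lemma len_simpleP s w : S s ->
  len S (s * w) = (len S w).+1 \/ len S w = (len S (s * w)).+1.
Proof.
move=> Ss; have := len_simple_le w Ss; have := len_simple_le (s * w) Ss.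
rewrite simpleK //; have := reflection_len_neq w (reflection_simple Ss).
by case: (ltngtP (len S (s * w)) (len S w)) => // lt _ h1 h2; [right|left]; apply/anti_leq/andP; split.
Qed.

Lemma len_simpleS s w : S s -> (len S w < len S (s * w))%N ->
  len S (s * w) = (len S w).+1.
Proof. by move=> Ss; case: (len_simpleP w Ss) => // ->; rewrite ltnNge leqnSn. Qed.

Lemma len_simplePr s w : S s ->
  len S (w * s) = (len S w).+1 \/ len S w = (len S (w * s)).+1.
Proof.
move=> Ss; have := len_simpleP w^-1 Ss.
by rewrite -{1 2}[s]simpleV // -invgM !lenV.
Qed.

(** If [s w t] is shorter than [s w], exchange [s] against the word [r t] of [w t], with [r] reduced
    for [w]. Deleting the final [t] gives [s w = w t]; deleting a letter of [r] contradicts the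
    length of [s w]. *)
Lemma folding s t w : S s -> S t ->
  len S (s * w) = (len S w).+1 -> len S (w * t) = (len S w).+1 ->
  len S (s * w * t) = (len S w).+2 \/ s * w = w * t.
Proof.
move=> Ss St sw wt.
have [|E] := len_simplePr (s * w) St; first by rewrite sw; left.
right; have [r [hr sr]] := reduced_exists w.
have hrt : expression S (w * t) (rcons r t).
  case: hr => rS ->; split; last by rewrite -cats1 big_cat big_seq1.
  by move=> x; rewrite mem_rcons inE => /orP[/eqP->|/rS].
have [|r' [sub sz hr']] := strong_exchange (reflection_simple Ss) hrt.
  by rewrite wt mulgA -ltnS -E sw.
move: sub sz hr'; rewrite size_rcons => sub [sz] hr'.
have [E'|ne] := eqVneq r r'.
  move: hr'; rewrite -E' => -[_ {}E'].
  have sww : s * (w * t) = w by rewrite E'; case: hr.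
  by rewrite -{1}sww simpleK.
exfalso.
(* The deleted letter lies in [r], so [r'] still ends in [t]; cancelling [t] leaves a word for [s w]
   shorter than [r]. *)
have [r1 e1 sub1] : exists2 r1, r' = rcons r1 t & subseq r1 r.
  case/lastP: r' sub sz ne {hr'} => [|r1 z].
    by move=> _ /esym/size0nil->; rewrite eqxx.
  move=> sub sz ne.
  have: subseq (rev (rcons r1 z)) (rev (rcons r t)) by rewrite subseq_rev.
  rewrite !rev_rcons /=; case: eqP => [->|_ sub']; first by rewrite subseq_rev; exists r1.
  case/eqP: ne; apply: (can_inj revK); rewrite rev_rcons; apply/esym/eqP.
  by rewrite -(size_subseq_leqif sub') /= !size_rev -sz size_rcons.
have sz1 : (size r1).+1 = size r by rewrite -sz e1 size_rcons.
have : expression S (s * w) r1.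
  case: hr' => r'S E2; split=> [x xr1|].
    by apply: r'S; rewrite e1 mem_rcons inE xr1 orbT.
  apply: (@mulIg _ t); rewrite -mulgA E2 e1.
  by rewrite -cats1 big_cat big_seq1.
move/len_le; rewrite sw -sr -sz1.
by rewrite ltnNge leqnSn.
Qed.

(** * The Bruhat order: subwords and lifting *)

Lemma bruhat_trans x y z : bruhat_le S x y -> bruhat_le S y z -> bruhat_le S x z.
Proof. by move=> xy; elim=> // w t _ IH rt lt; exact: bruhat_step. Qed.

Lemma bruhat_len x y : bruhat_le S x y -> x = y \/ (len S x < len S y)%N.
Proof.
elim=> [|w t _ IH rt lt]; first by left.
by right; case: IH => [->//|]; move/ltn_trans; apply.
Qed.

(** The definition multiplies by reflections on the right; conjugation by [w] moves a left factor
    there. *)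
Lemma bruhat_left t w : reflection S t -> (len S w < len S (t * w))%N ->
  bruhat_le S w (t * w).
Proof.
move=> rt; have -> : t * w = w * (w^-1 * t * w^-1^-1).
  by rewrite invgK !mulgA mulgV mul1g.
move=> lt; apply: bruhat_step => //; first exact: bruhat_refl.
exact: reflectionJ.
Qed.

Lemma bruhat_simple s w : S s -> (len S w < len S (s * w))%N ->
  bruhat_lt S w (s * w).
Proof.
move=> Ss lt; split; first exact: bruhat_left (reflection_simple Ss) lt.
by move=> E; rewrite -E ltnn in lt.
Qed.

Lemma bruhat_inv x y : bruhat_le S x y -> bruhat_le S x^-1 y^-1.
Proof.
elim=> [|w t _ IH rt lt]; first exact: bruhat_refl.
apply: (bruhat_trans IH); rewrite invgM (reflectionV rt).
apply: bruhat_left => //.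
by rewrite -(reflectionV rt) -invgM !lenV.
Qed.

(** Each step down the Bruhat chain deletes a letter by strong exchange. The word [r] may be
    non-reduced. *)
Lemma bruhat_subword x w r : bruhat_le S x w -> expression S w r ->
  exists2 r', subseq r' r & expression S x r'.
Proof.
move=> xw; elim: xw r => [|z t _ IH rt lt] r hr; first by exists r.
have Ez : z * t * z^-1 * (z * t) = z.
  by rewrite !mulgA mulgVK -mulgA reflection_tt // mulg1.
have [|r' [sub _]] := strong_exchange (reflectionJ z rt) hr; first by rewrite Ez.
rewrite Ez => /IH[r2 sub2 hr2]; exists r2 => //.
exact: subseq_trans sub.
Qed.

(** Everything below [w] is the product of a subword of one fixed word, and such subwords are given
    by bit masks. *)
Lemma bruhat_finite w : finite_set [set x | bruhat_le S x w].
Proof.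
have [r hr] := expression_exists w.
apply: (@sub_finite_set _ _
  [set \prod_(s <- mask (val m) r) s | m in [set: (size r).-tuple bool]]).
  move=> x /bruhat_subword/(_ hr)[r' /subseqP[m sm ->] [_ ->]].
  by exists (tcast sm (in_tuple m)) => //; rewrite /= val_tcast.
exact: finite_image.
Qed.

(** The critical case is [s x > x] and [s x t < s x]. Exchange deletes a letter of the word [s r] of
    [s x]: deleting [s] gives [s x = x t], while deleting a letter of [r] would make [x t] shorter
    than [x]. *)
Lemma bruhat_lift1 s x t : S s -> reflection S t -> (len S x < len S (x * t))%N ->
  bruhat_le S (s * x) (x * t) \/ bruhat_le S (s * x) (s * x * t).
Proof.
move=> Ss rt lt; have xt : bruhat_le S x (x * t).
  by apply: bruhat_step => //; exact: bruhat_refl.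
have [sx|sx] := len_simpleP x Ss; last first.
  left; apply: bruhat_trans xt; rewrite -{2}[x](simpleK x Ss).
  by apply: bruhat_left; rewrite ?simpleK ?sx //; exact: reflection_simple.
have [r [hr sr]] := reduced_exists x.
have rt' : reflection S (s * x * t * (s * x)^-1) by exact: reflectionJ.
have := reflection_len_neq (s * x) rt'; rewrite mulgVK.
case: ltngtP => // lt' _; last first.
  by right; apply: bruhat_step => //; exact: bruhat_refl.
left; have [|r' [sub sz]] := strong_exchange rt' (expression_cons Ss hr).
  by rewrite mulgVK.
rewrite mulgVK => -[r'S E]; case: r' r'S sub sz E => [|z r'] r'S.
  move=> _ [/esym/size0nil r0]; rewrite big_nil => E.
  have x1 : x = 1 by case: hr => _ ->; rewrite r0 big_nil.
  rewrite x1 mulg1 mul1g in E *.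
  have -> : t = s by rewrite -[t](simpleK t Ss) E mulg1.
  exact: bruhat_refl.
rewrite /=; case: eqP => [->|_] sub [sz]; last first.
  have Er : r = z :: r'.
    by apply/esym/eqP; rewrite -(size_subseq_leqif sub) /= sz.
  have -> : \prod_(j <- z :: r') j = x by case: hr => _ ->; rewrite Er.
  move=> E; have -> : s * x = x * t; last exact: bruhat_refl.
  by rewrite -{1}E -mulgA simpleK.
rewrite big_cons -mulgA => /mulgI E.
have : expression S (x * t) r'.
  by split=> // y yr; apply: r'S; rewrite inE yr orbT.
move/len_le; rewrite leqNgt => /negP[].
by apply: leq_trans lt; rewrite -sr -sz.
Qed.

Lemma bruhat_lift s x w : S s -> bruhat_le S x w ->
  bruhat_le S (s * x) w \/ bruhat_le S (s * x) (s * w).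
Proof.
move=> Ss; elim=> [|z t _ IH rt lt]; first by right; exact: bruhat_refl.
have zt : bruhat_le S z (z * t) by apply: bruhat_step => //; exact: bruhat_refl.
case: IH => [h|h]; first by left; exact: bruhat_trans zt.
have [h'|h'] := bruhat_lift1 Ss rt lt; [left|right]; first exact: bruhat_trans h'.
by rewrite mulgA; exact: bruhat_trans h'.
Qed.

(** In the second case of the lifting property, [s w < w] brings the bound back to [w]. *)
Lemma bruhat_descent s x w : S s -> (len S (s * w) < len S w)%N ->
  bruhat_le S x w -> bruhat_le S (s * x) w.
Proof.
move=> Ss lt /(bruhat_lift Ss)[//|h]; apply: bruhat_trans h _.
rewrite -{2}[w](simpleK w Ss); apply: bruhat_left; first exact: reflection_simple.
by rewrite simpleK.
Qed.

(** The lower interval of [w] is stable under each [s] in [K], hence under the generated group. The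
    induction carries [p^-1] along because [gen_ind] requires closure under inversion. *)
Lemma bruhat_gen (K : set W) w p x : K `<=` S ->
  (forall s, K s -> len S (s * w) < len S w)%N ->
  gen K p -> bruhat_le S x w -> bruhat_le S (p * x) w.
Proof.
move=> KS Kw Kp; have [+ _] : (forall x, bruhat_le S x w -> bruhat_le S (p * x) w)
  /\ (forall x, bruhat_le S x w -> bruhat_le S (p^-1 * x) w); last by apply.
move: p Kp {x}; apply: gen_ind => [|p q [p1 p2] [q1 q2]|p [p1 p2]|s Ks].
- by split=> x; rewrite ?invg1 mul1g.
- by split=> x h; rewrite ?invgM -mulgA; [apply/p1/q1|apply/q2/p2].
- by split; rewrite ?invgK.
- by rewrite simpleV; [split=> x; apply: bruhat_descent; auto|exact: KS].
Qed.

End Words.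

(** * Twisted involutions in double cosets *)

Section TwistedInvolutions.
Local Open Scope group_scope.
Variables (W : groupType) (S : set W) (star : W -> W).
Hypotheses (hW : coxeter_system S) (hstar : diagram_involution S star).

Lemma starM : {morph star : x y / x * y}. Proof. by case: hstar. Qed.
Lemma starK : involutive star. Proof. by case: hstar. Qed.
Lemma star_simple s : S s -> S (star s). Proof. by case: hstar => _ _; apply. Qed.

Lemma star1 : star 1 = 1.
Proof. by apply: (@mulgI _ (star 1)); rewrite mulg1 -starM mulg1. Qed.

Lemma starV x : star x^-1 = (star x)^-1.
Proof. by apply/esym/mulg1_eq; rewrite -starM mulgV star1. Qed.

Lemma len_star w : len S (star w) = len S w.
Proof.
have H x : (len S (star x) <= len S x)%N.
  have [r [hr <-]] := reduced_exists hW x.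
  rewrite -(size_map star); apply: len_le => //.
  case: hr => rS ->; split=> [s /mapP[t /rS St ->]|]; first exact: star_simple.
  elim: r {rS} => [|s r IH]; first by rewrite !big_nil star1.
  by rewrite /= !big_cons starM IH.
by apply/eqP; rewrite eqn_leq H -{1}(starK w) H.
Qed.

Lemma IstarE w : Istar star w -> star w = w^-1.
Proof. by move=> {2}<-; rewrite invgK. Qed.

Lemma Istar_len s w : S s -> Istar star w -> len S (w * star s) = len S (s * w).
Proof.
move=> Ss Iw; rewrite -len_star starM starK (IstarE Iw) -(lenV hW).
by rewrite invgM invgK (simpleV hW).
Qed.

(** The operation written [s * w] or [s w s^*] according to whether
    [s w = w s^*]; it links the basis elements occurring in [T_s a_w]. *)
Definition sact s w := if s * w == w * star s then s * w else s * w * star s.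

Lemma sact_comm s w : S s ->
  (s * sact s w == sact s w * star s) = (s * w == w * star s).
Proof.
move=> Ss; have Ss' := star_simple Ss; rewrite /sact; case: ifP => [/eqP|] E.
  by rewrite {2}E (simpleKr hW) // (simpleK hW) // eqxx.
by rewrite -[s * w * _]mulgA (simpleK hW) // [s * (w * _)]mulgA (simpleKr hW) // eq_sym.
Qed.

Lemma sactK s w : S s -> sact s (sact s w) = w.
Proof.
move=> Ss; rewrite {1}/sact sact_comm //; case: ifP => E; rewrite /sact E.
  by rewrite (simpleK hW).
by rewrite -[s * w * _]mulgA (simpleK hW) // (simpleKr hW) //; exact: star_simple.
Qed.

Lemma sact_Istar s w : S s -> Istar star w -> Istar star (sact s w).
Proof.
move=> Ss Iw; rewrite /sact /Istar /=; case: ifP => [/eqP|] E.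
  by rewrite starM (IstarE Iw) invgM invgK -starV (simpleV hW Ss) E.
by rewrite !starM starK (IstarE Iw) !invgM invgK -starV !(simpleV hW Ss) mulgA.
Qed.

(** When [s w] and [w s^*] differ, both are longer than [w] by one, and [folding] makes [s w s^*]
    longer by two. *)
Lemma sact_len_up s w : S s -> Istar star w -> (len S w < len S (s * w))%N ->
  len S (sact s w) = (len S w + (if (s * w == w * star s)%g then 1 else 2))%N.
Proof.
move=> Ss Iw lt; rewrite /sact; have E := len_simpleS hW Ss lt.
case: ifP => [_|/eqP ne]; first by rewrite E addn1.
have [] := folding hW Ss (star_simple Ss) E; rewrite ?addn2 //.
by rewrite Istar_len.
Qed.

Lemma sact_up_down s w : S s -> Istar star w -> (len S w < len S (s * w))%N ->
  (len S (s * sact s w) < len S (sact s w))%N.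
Proof.
move=> Ss Iw lt; rewrite sact_len_up //; rewrite /sact.
case: ifP => [_|/eqP ne]; first by rewrite (simpleK hW) // addn1.
rewrite -mulgA (simpleK hW) // Istar_len // (len_simpleS hW Ss lt).
by rewrite addn2.
Qed.

Lemma sact_down_up s w : S s -> Istar star w -> (len S (s * w) < len S w)%N ->
  (len S (sact s w) < len S (s * sact s w))%N.
Proof.
move=> Ss Iw lt; have Ss' := star_simple Ss.
rewrite /sact; case: ifP => [_|/eqP ne]; first by rewrite (simpleK hW).
rewrite -[s * w * _]mulgA (simpleK hW) // ltnNge; apply/negP => le.
have lw : len S w = (len S (w * star s)).+1.
  have [|//] := len_simplePr hW w Ss'; rewrite Istar_len //.
  by move=> E; rewrite E ltnNge leqnSn in lt.
have E : len S (s * (w * star s)) = (len S (w * star s)).+1.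
  have [//|E] := len_simpleP hW (w * star s) Ss.
  by rewrite E ltnn in le.
(* Folding is applied to [w s^*], which is shorter than [w]: one outcome contradicts [s w < w], the
   other the assumption that [s w] and [w s^*] differ. *)
have [] := folding hW Ss Ss' E; rewrite ?(simpleKr hW) //.
  rewrite mulgA (simpleKr hW) // => E2.
  by move: lt; rewrite E2 lw ltnNge leqnSn.
move=> E2; case: ne; apply: (@mulIg _ (star s)).
by rewrite (simpleKr hW) // -mulgA.
Qed.

Lemma sact_len_down s w : S s -> Istar star w -> (len S (s * w) < len S w)%N ->
  len S w = (len S (sact s w) + (if (s * w == w * star s)%g then 1 else 2))%N.
Proof.
move=> Ss Iw lt; rewrite -{1}(sactK w Ss) sact_len_up //.
- by rewrite sact_comm.
- exact: sact_Istar.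
- exact: sact_down_up.
Qed.

(** * Longest elements of finite double cosets *)

Section Parabolic.
Variable K : set W.
Hypotheses (hKS : K `<=` S) (hK : finite_set (gen K)).

Lemma star_gen p : gen K p -> gen (star @` K) (star p).
Proof.
move: p; apply: gen_ind => [|x y hx hy|x hx|s Ks].
- by rewrite star1; exact: gen1.
- by rewrite starM; exact: genM.
- by rewrite starV; exact: genV.
- by apply: mem_gen; exists s.
Qed.

Lemma gen_star q : gen (star @` K) q -> gen K (star q).
Proof.
move: q; apply: gen_ind => [|x y hx hy|x hx|_ [s Ks <-]].
- by rewrite star1; exact: gen1.
- by rewrite starM; exact: genM.
- by rewrite starV; exact: genV.
- by rewrite starK; exact: mem_gen.
Qed.

Definition dcoset x : set W :=
  [set w | exists p q, [/\ gen K p, gen (star @` K) q & w = p * x * q]].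

Lemma dcoset_refl x : dcoset x x.
Proof. by exists 1, 1; rewrite mul1g mulg1; split => //; exact: gen1. Qed.

Lemma double_cosetE Om y : double_coset star K Om -> Om y -> Om = dcoset y.
Proof.
move=> [x ->] [p [q [hp hq ->]]]; apply/seteqP; split=> w [p' [q' [hp' hq' ->]]].
  exists (p' * p^-1), (q^-1 * q'); split.
  - by apply: genM => //; exact: genV.
  - by apply: genM => //; exact: genV.
  - by rewrite !mulgA mulgVK mulgK.
exists (p' * p), (q * q'); split; [exact: genM|exact: genM|].
by rewrite !mulgA.
Qed.

Lemma dcoset_double x : double_coset star K (dcoset x).
Proof. by exists x. Qed.

Lemma double_cosetL Om s y : double_coset star K Om -> K s -> Om y -> Om (s * y).
Proof.
move=> dO Ks Oy; rewrite (double_cosetE dO Oy).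
by exists s, 1; rewrite mulg1; split; [exact: mem_gen|exact: gen1|].
Qed.

Lemma double_cosetR Om s y : double_coset star K Om -> K s -> Om y ->
  Om (y * star s).
Proof.
move=> dO Ks Oy; rewrite (double_cosetE dO Oy).
by exists 1, (star s); rewrite mul1g; split; [exact: gen1|apply: mem_gen; exists s|].
Qed.

Lemma double_coset_sact Om s y : double_coset star K Om -> K s -> Om y ->
  Om (sact s y).
Proof.
move=> dO Ks Oy; rewrite /sact; case: ifP => _; first exact: double_cosetL.
by apply: double_cosetR => //; exact: double_cosetL.
Qed.

Lemma dcoset_finite x : finite_set (dcoset x).
Proof.
have fK : finite_set (gen (star @` K)).
  apply: (@sub_finite_set _ _ (star @` gen K)); last exact: finite_image.
  by move=> q /gen_star h; exists (star q) => //; exact: starK.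
apply: (@sub_finite_set _ _ ((fun pq => pq.1 * x * pq.2) @` (gen K `*` gen (star @` K)))).
  by move=> w [p [q [hp hq ->]]]; exists (p, q).
by apply: finite_image; exact: finite_setX.
Qed.

Lemma dcoset_IstarK x : Istar star x -> IstarK star K (dcoset x).
Proof.
move=> Ix; split; first exact: dcoset_double.
move=> w [p [q [hp hq ->]]]; exists (star q)^-1, (star p)^-1; split.
- by apply: genV; exact: gen_star.
- by apply: genV; exact: star_gen.
- by rewrite !starM (IstarE Ix) !invgM invgK mulgA.
Qed.

(** The coset is finite, so some element attains the maximal length and [xget] picks such an
    element. *)
Lemma dmaxP Om : double_coset star K Om ->
  Om (dmax S Om) /\ forall x, Om x -> (len S x <= len S (dmax S Om))%N.
Proof.
move=> [x ->]; set O := [set w | _].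
have fO : finite_set O by exact: dcoset_finite.
have Ox : O x by exact: dcoset_refl.
rewrite /dmax; case: xgetP => [y _ //|/= none]; exfalso.
have [s Es] := (finite_seqP O).1 fO.
have : x \in s by move: Ox; rewrite Es.
have : forall y, y \in s -> O y by move=> y; rewrite Es.
have : forall y, O y -> y \in s by move=> y; rewrite Es.
move=> sO Os xs.
have [y [ys ymax]] : exists y, y \in s /\ forall z, z \in s -> (len S z <= len S y)%N.
  pose Q n := has (fun z => len S z == n) s.
  have exQ : exists n, Q n by exists (len S x); apply/hasP; exists x.
  have bQ n : Q n -> (n <= \max_(z <- s) len S z)%N.
    by move=> /hasP[z zs /eqP<-]; exact: leq_bigmax_seq.
  case: (ex_maxnP exQ bQ) => m /hasP[y ys /eqP<-] ymax.
  by exists y; split=> // z zs; apply: ymax; apply/hasP; exists z.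
by apply: (none y); split; [exact: Os|move=> z /sO; exact: ymax].
Qed.

(** The left factor is absorbed by [bruhat_gen]; the right factor likewise after inversion, which
    turns right descents of [y] into left descents of [y^-1]. *)
Lemma dcoset_bruhat x y :
  (forall s, K s -> len S (s * y) < len S y)%N ->
  (forall s, K s -> len S (y * star s) < len S y)%N ->
  dcoset y x -> bruhat_le S x y.
Proof.
move=> yl yr [p [q [hp hq ->]]].
rewrite -mulgA; apply: (bruhat_gen hW hKS yl hp).
rewrite -[y * q]invgK -[y in X in bruhat_le _ _ X]invgK invgM; apply: bruhat_inv => //.
apply: (bruhat_gen hW (K := star @` K)); last exact: bruhat_refl.
- by move=> _ [s Ks <-]; apply/star_simple/hKS.
- move=> _ [s Ks <-]; rewrite (lenV hW) -(lenV hW) invgM invgK -starV (simpleV hW).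
    exact: yr.
  exact: hKS.
- exact: genV.
Qed.

Lemma dmax_descentL Om s : double_coset star K Om -> K s ->
  (len S (s * dmax S Om) < len S (dmax S Om))%N.
Proof.
move=> dO Ks; have [Od dm] := dmaxP dO.
have Ss := hKS Ks.
have := reflection_len_neq hW (dmax S Om) (reflection_simple Ss).
rewrite neq_ltn => /orP[//|]; rewrite ltnNge dm //.
exact: double_cosetL.
Qed.

Lemma dmax_descentR Om s : double_coset star K Om -> K s ->
  (len S (dmax S Om * star s) < len S (dmax S Om))%N.
Proof.
move=> dO Ks; have [Od dm] := dmaxP dO.
have Ss := star_simple (hKS Ks).
have : (len S (dmax S Om * star s) <= len S (dmax S Om))%N.
  by apply: dm; exact: double_cosetR.
by case: (len_simplePr hW (dmax S Om) Ss) => ->; rewrite ?ltnn.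
Qed.

Lemma dmax_unique Om y : double_coset star K Om -> Om y ->
  (forall x, Om x -> bruhat_le S x y) -> y = dmax S Om.
Proof.
move=> dO Oy ymax; have [Od dm] := dmaxP dO.
have [->//|] := bruhat_len (ymax _ Od).
by rewrite ltnNge dm.
Qed.

Lemma dmax_Istar Om : IstarK star K Om -> Istar star (dmax S Om).
Proof.
move=> [dO Ost]; have [Od dm] := dmaxP dO.
have dl := fun s => dmax_descentL (s := s) dO.
have dr := fun s => dmax_descentR (s := s) dO.
have le x : Om x -> bruhat_le S x (dmax S Om).
  by rewrite {1}(double_cosetE dO Od); exact: dcoset_bruhat.
have [//|] := bruhat_len (le _ (Ost _ Od)).
by rewrite (lenV hW) len_star ltnn.
Qed.

(** Induction on the length deficit: as long as some [s] in [K] is an ascent of [y], moving to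
    [sact s y] stays in the coset, keeps the value of [f] and increases the length. *)
Lemma dmax_const (V : Type) (f : W -> V) Om :
  (forall s w, K s -> Istar star w -> (len S w < len S (s * w))%N ->
    f (sact s w) = f w) ->
  double_coset star K Om ->
  forall y, Istar star y -> Om y -> f y = f (dmax S Om).
Proof.
move=> fK dO y; have [Od dm] := dmaxP dO.
have [n] := ubnP (len S (dmax S Om) - len S y).
elim: n y => // n IH y hn Iy Oy.
have OmE := double_cosetE dO Oy.
have [[s [Ks lt]]|none] := pselect (exists s, K s /\ (len S y < len S (s * y))%N).
  rewrite -(fK s) //; apply: IH; last first.
  - exact: double_coset_sact.
  - exact: sact_Istar (hKS Ks) Iy.
  - move: hn; rewrite ltnS => hn; apply: leq_trans hn; apply: ltn_sub2l.
      apply: leq_trans lt _; apply: dm.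
      exact: double_cosetL.
    by rewrite sact_len_up //; [case: ifP; rewrite ?addn1 ?addn2|exact: hKS].
(* All of [K] consists of left descents of [y]. By [Istar_len] the right descents follow, so [y]
   dominates its coset. *)
congr f; apply: dmax_unique => //.
have yl s : K s -> (len S (s * y) < len S y)%N.
  move=> Ks; have := reflection_len_neq hW y (reflection_simple (hKS Ks)).
  by rewrite neq_ltn => /orP[//|lt]; case: none; exists s.
rewrite OmE => x; apply: dcoset_bruhat => // s Ks.
by rewrite Istar_len //; [exact: yl|exact: hKS].
Qed.

End Parabolic.
End TwistedInvolutions.

(** * Coordinates and Laurent polynomials *)

Lemma sum_pick (R : pzRingType) (J : eqType) (L : seq J) (f : J -> R) (z : J) :
  uniq L -> (forall y, y \notin L -> f y = 0) ->
  \sum_(y <- L) f y * (y == z)%:R = f z.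
Proof.
move=> uL f0; have [zL|zL] := boolP (z \in L).
  rewrite (bigD1_seq z) //= eqxx mulr1 big1 ?addr0 // => i /negbTE->.
  by rewrite mulr0.
rewrite f0 // big1_seq // => i /= iL.
by case: eqP => [im|_]; rewrite ?mulr0 //; rewrite -im iL in zL.
Qed.

Section Coordinates.
Variables (R : nzRingType) (V : zmodType) (sc : R -> V -> V).
Variables (J : choiceType) (D : set J) (b : J -> V).
Hypothesis hb : basis_on sc D b.
Hypothesis scDl : forall x, {morph sc^~ x : r r' / r + r'}.
Hypothesis scDr : forall r, {morph sc r : x y / x + y}.
Hypothesis scA : forall r r' x, sc r (sc r' x) = sc (r * r') x.
Hypothesis sc1 : forall x, sc 1 x = x.

(** The action [sc] is kept abstract because these coordinates serve both for integers acting on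
    Laurent polynomials and for [bscale] on [M]. *)
Definition bcoord (x : V) : J -> R := sval (cid (hb x)).

Let sc0 x : sc 0 x = 0.
Proof. by apply: (addrI (sc 0 x)); rewrite -scDl !addr0. Qed.

Let scr0 r : sc r 0 = 0.
Proof. by apply: (addrI (sc r 0)); rewrite -scDr !addr0. Qed.

(** The summand [f] is arbitrary so that the same statement also evaluates [lbar]. *)
Lemma bcoord_expand (f : R -> J -> V) (c : J -> R) (L : seq J) :
  (forall i, f 0 i = 0) -> uniq L -> [set` L] `<=` D -> (forall i, i \notin L -> c i = 0) ->
  \sum_(i \in D) f (c i) i = \sum_(i <- L) f (c i) i.
Proof. move=> f0 uL LD c0; rewrite (fsbigE L) //; last by move=> i _ /c0->.
rewrite big_seq_cond [RHS]big_seq_cond; apply: eq_bigl => i.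
by case: (boolP (i \in L)) => //= /LD/mem_set->.
Qed.

Lemma bcoord_unique x (c : J -> R) (L : seq J) :
  uniq L -> [set` L] `<=` D -> (forall i, i \notin L -> c i = 0) ->
  x = \sum_(i <- L) sc (c i) (b i) -> bcoord x = c.
Proof.
move=> uL LD c0 xE; rewrite /bcoord; case: cid => d /= [_]; apply.
have sub : [set i | c i <> 0] `<=` [set` L].
  by move=> i /= ci; apply/negP => /negP/c0.
split; last by rewrite (bcoord_expand (f := fun r i => sc r (b i)) (L := L)).
- by apply: sub_finite_set sub _; exact: finite_seq.
- exact: subset_trans sub LD.
Qed.

Lemma bcoord_support x : exists L : seq J,
  [/\ uniq L, [set` L] `<=` D & forall i, i \notin L -> bcoord x i = 0].
Proof.
rewrite /bcoord; case: cid => d /= [[fin sub _] _].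
exists (fset_set [set i | d i <> 0]); split; first exact: fset_uniq.
  by move=> i /=; rewrite in_fset_set // inE => /sub.
by move=> i; rewrite in_fset_set // notin_setE /= => /contrapT.
Qed.

Lemma bcoord_sum x (L : seq J) :
  uniq L -> [set` L] `<=` D -> (forall i, i \notin L -> bcoord x i = 0) ->
  x = \sum_(i <- L) sc (bcoord x i) (b i).
Proof.
move=> uL LD c0; rewrite -(bcoord_expand (f := fun r i => sc r (b i)) (L := L)) //.
by rewrite /bcoord; case: cid => d /= [[_ _ ->] _].
Qed.

Lemma bcoordD x y i : bcoord (x + y) i = bcoord x i + bcoord y i.
Proof.
have [Lx [ux xD x0]] := bcoord_support x; have [Ly [uy yD y0]] := bcoord_support y.
pose L := undup (Lx ++ Ly).
have uL : uniq L by exact: undup_uniq.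
have LD : [set` L] `<=` D.
  by move=> k /=; rewrite mem_undup mem_cat => /orP[/xD|/yD].
have Lx0 k : k \notin L -> bcoord x k = 0.
  by rewrite mem_undup mem_cat negb_or => /andP[/x0].
have Ly0 k : k \notin L -> bcoord y k = 0.
  by rewrite mem_undup mem_cat negb_or => /andP[_ /y0].
rewrite (@bcoord_unique _ (fun k => bcoord x k + bcoord y k) L) //.
  by move=> k kL; rewrite Lx0 // Ly0 // addr0.
rewrite {1}(bcoord_sum uL LD Lx0) {1}(bcoord_sum uL LD Ly0) -big_split /=.
by apply: eq_bigr => k _; rewrite scDl.
Qed.

Lemma bcoordZ r x i : bcoord (sc r x) i = r * bcoord x i.
Proof.
have [L [uL LD x0]] := bcoord_support x.
rewrite (@bcoord_unique _ (fun k => r * bcoord x k) L) //.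
  by move=> k kL; rewrite x0 // mulr0.
rewrite {1}(bcoord_sum uL LD x0) (big_morph _ (scDr r) (scr0 r)).
by apply: eq_bigr => k _; rewrite scA.
Qed.

Lemma bcoord_basis i k : D i -> bcoord (b i) k = (i == k)%:R.
Proof.
move=> Di; rewrite (@bcoord_unique _ (fun k => (i == k)%:R) [:: i]) //.
- by move=> z /=; rewrite inE => /eqP->.
- by move=> z; rewrite inE eq_sym => /negbTE->.
- by rewrite big_seq1 eqxx sc1.
Qed.

End Coordinates.

(** * Coefficients of Laurent polynomials *)

Section Laurent.
Variables (B : comUnitRingType) (v : B).
Hypothesis hv : laurent_ring v.

Lemma laurent_unit : v \is a GRing.unit. Proof. by case: hv. Qed.

Definition lcoef (r : B) (n : int) : int := bcoord (proj2 hv) r n.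

Let scDl (x : B) : {morph (fun k : int => x *~ k) : r r' / r + r'}.
Proof. by move=> r r'; rewrite mulrzDr. Qed.
Let scDr (k : int) : {morph (fun x : B => x *~ k) : x y / x + y}.
Proof. by move=> x y; rewrite mulrzDl. Qed.
Let scA (k k' : int) (x : B) : x *~ k' *~ k = x *~ (k * k').
Proof. by rewrite -mulrzA mulrC. Qed.

Lemma lcoefD r r' n : lcoef (r + r') n = lcoef r n + lcoef r' n.
Proof. exact: bcoordD. Qed.

Lemma lcoefMz r k n : lcoef (r *~ k) n = k * lcoef r n.
Proof. exact: (bcoordZ (proj2 hv) scDl scDr scA). Qed.

Lemma lcoefX m n : lcoef (v ^ m) n = (m == n)%:R.
Proof. by apply: (bcoord_basis (proj2 hv)). Qed.

Lemma lcoef0 n : lcoef 0 n = 0.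
Proof. by rewrite -(mulr0z 1) lcoefMz mul0r. Qed.

Lemma lcoefN r n : lcoef (- r) n = - lcoef r n.
Proof. by rewrite -[- r]mulrN1z lcoefMz mulN1r. Qed.

Lemma lcoefB r r' n : lcoef (r - r') n = lcoef r n - lcoef r' n.
Proof. by rewrite lcoefD lcoefN. Qed.

Lemma lcoef_sum (I : Type) (L : seq I) (Q : pred I) (F : I -> B) n :
  lcoef (\sum_(i <- L | Q i) F i) n = \sum_(i <- L | Q i) lcoef (F i) n.
Proof. by apply: (big_morph (lcoef^~ n)) => [x y|]; rewrite ?lcoefD ?lcoef0. Qed.

Lemma lcoef_support r : exists2 L : seq int, uniq L &
  forall n, n \notin L -> lcoef r n = 0.
Proof. by have [L [? _ ?]] := bcoord_support (proj2 hv) r; exists L. Qed.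

Lemma lcoef_expand r (L : seq int) : uniq L -> (forall n, n \notin L -> lcoef r n = 0) ->
  r = \sum_(n <- L) v ^ n *~ lcoef r n.
Proof. by move=> uL L0; apply: (bcoord_sum (hb := proj2 hv) scDl uL). Qed.

Lemma lcoef_eq0 r : (forall n, lcoef r n = 0) -> r = 0.
Proof. by move=> r0; rewrite (@lcoef_expand r [::]) ?big_nil. Qed.

Let sum_delta (L : seq int) (c : int -> int) (f : int -> int) n m :
  uniq L -> (forall n, n \notin L -> c n = 0) -> (forall i, (f i == n) = (i == m)) ->
  \sum_(i <- L) c i * (f i == n)%:R = c m.
Proof.
move=> uL c0 fE; under eq_bigr => i _ do rewrite fE.
exact: sum_pick.
Qed.

Lemma lcoefXM m r n : lcoef (v ^ m * r) n = lcoef r (n - m).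
Proof.
have [L uL r0] := lcoef_support r.
rewrite {1}(lcoef_expand uL r0) mulr_sumr lcoef_sum.
rewrite -(@sum_delta L (lcoef r) (fun i => m + i) n (n - m)) //; last first.
  by move=> i; rewrite [RHS]eq_sym subr_eq addrC eq_sym.
apply: eq_bigr => i _.
by rewrite mulrzAr lcoefMz -exprzDr ?laurent_unit // lcoefX.
Qed.

(** Provides the starting point for divisions carried out from the lowest degree upwards. *)
Lemma lcoef_lower r : exists N : int, forall n, n < N -> lcoef r n = 0.
Proof.
have [L _ r0] := lcoef_support r.
have [N NL] : exists N : int, forall n, n \in L -> (N <= n)%R.
  elim: L {r0} => [|n L [N IH]]; first by exists 0.
  exists (Num.min n N) => m; rewrite inE ge_min => /orP[/eqP->|/IH->].
    by rewrite lexx.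
  by rewrite orbT.
by exists N => n ltn; apply: r0; apply/negP => /NL; rewrite leNgt ltn.
Qed.

Definition lbar (r : B) : B := \sum_(n \in [set: int]) v ^ (- n) *~ lcoef r n.

Lemma lbar_expand r (L : seq int) : uniq L -> (forall n, n \notin L -> lcoef r n = 0) ->
  lbar r = \sum_(n <- L) v ^ (- n) *~ lcoef r n.
Proof.
by move=> uL L0; apply: (bcoord_expand (f := fun k n => v ^ (- n) *~ k) (L := L)).
Qed.

Lemma lcoef_lbar r n : lcoef (lbar r) n = lcoef r (- n).
Proof.
have [L uL r0] := lcoef_support r.
rewrite (lbar_expand uL r0) lcoef_sum.
rewrite -(@sum_delta L (lcoef r) -%R n (- n)) //; last first.
  by move=> i; rewrite eqr_oppLR.
by apply: eq_bigr => i _; rewrite lcoefMz lcoefX.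
Qed.

End Laurent.

(** * The elements [A_w] *)

Section ScalarExtension.
Variables (A B : comUnitRingType) (iota : {rmorphism A -> B}).
Variables (H : unitAlgType A) (M : lmodType H) (N : lmodType B) (j : {additive M -> N}).
Hypothesis hN : scalar_extension iota (@bscale A H M) j.

Lemma bscaleDl (m : M) : {morph (fun c : A => bscale c m) : c c' / c + c'}.
Proof. by move=> c c'; rewrite /bscale !scalerDl. Qed.

Lemma bscaleDr (c : A) : {morph (fun m : M => bscale c m) : m m' / m + m'}.
Proof. by move=> m m'; rewrite /bscale scalerDr. Qed.

Lemma bscaleA (c c' : A) (m : M) : bscale c (bscale c' m) = bscale (c * c') m.
Proof. by rewrite /bscale scalerA -scalerAl mul1r scalerA. Qed.

Lemma bscale1 (m : M) : bscale 1 m = m.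
Proof. by rewrite /bscale !scale1r. Qed.

Lemma ext_scale c m : j (bscale c m) = iota c *: j m.
Proof. by case: hN. Qed.

(* The universal property is applied to the coordinates on [M]. *)
Lemma ext_coord_exists (J : choiceType) (D : set J) (b : J -> M) :
  basis_on (@bscale A H M) D b ->
  exists co : J -> {linear N -> B^o},
    forall z y, D y -> co z (j (b y)) = (y == z)%:R.
Proof.
move=> hb; case: hN => _ univ.
have ex z : exists g : {linear N -> B^o}, forall m, g (j m) = iota (bcoord hb m z).
  pose f (m : M) : B^o := iota (bcoord hb m z).
  have fB : zmod_morphism f.
    move=> m m'; rewrite /f -rmorphB; congr (iota _).
    by apply/eqP; rewrite eq_sym subr_eq -(bcoordD hb bscaleDl) subrK.
  pose F : {additive M -> B^o} := HB.pack f (GRing.isZmodMorphism.Build _ _ f fB).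
  have [|g [gF _]] := univ B^o F.
    move=> c m; rewrite /F /= /f.
    by rewrite (bcoordZ hb bscaleDl bscaleDr bscaleA) rmorphM.
  by exists g => m; rewrite gF.
have [co coE] := choice ex; exists co => z y Dy.
by rewrite coE (bcoord_basis hb bscaleDl bscale1) // rmorph_nat.
Qed.

(** Scalars from [A] are central in [H], so the action of [h] is [A]-linear and the universal
    property extends it. *)
Lemma ext_act_exists (h : H) :
  exists t : {linear N -> N}, forall m, t (j m) = j (h *: m).
Proof.
case: hN => _ univ.
have fB : zmod_morphism (fun m => j (h *: m)).
  by move=> m m'; rewrite scalerBr raddfB.
pose F : {additive M -> N} := HB.pack (fun m => j (h *: m))
  (GRing.isZmodMorphism.Build _ _ (fun m => j (h *: m)) fB).
have [|g [gF _]] := univ N F; last by exists g.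
move=> c m; rewrite /F /= -ext_scale /bscale !scalerA.
by rewrite -scalerAl mul1r -scalerAr mulr1.
Qed.

End ScalarExtension.

Lemma span_scaleD (R : nzRingType) (V : lmodType R) (Q : set V) (c : R) (b x : V) :
  Q b -> Defs.span Q x -> Defs.span Q (c *: b + x).
Proof.
move=> Qb [n [d [e [Qe ->]]]].
exists n.+1, (fun i => oapp d c (unlift ord0 i)), (fun i => oapp e b (unlift ord0 i)).
split=> [i|]; first by case: (unlift _ _) => /=.
rewrite big_ord_recl unlift_none /=; congr (_ + _).
by apply: eq_bigr => i _; rewrite liftK.
Qed.

(** * The bar operator and the coefficients of [A_w] *)

Section KazhdanLusztig.
Variables (W : groupType) (S : set W) (star : W -> W).
Hypotheses (hW : coxeter_system S) (hstar : diagram_involution S star).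
Variables (A uA : comUnitRingType) (u : A) (v : uA) (iota : {rmorphism A -> uA}).
Hypotheses (hA : laurent_ring u) (huA : laurent_ring v) (hiota : iota u = v ^+ 2).
Variables (H : unitAlgType A) (T : W -> H).
Hypothesis hH : hecke_algebra S u T.
Variable barH : {rmorphism H -> H}.
Hypothesis hbarH : hecke_bar u T barH.
Variables (M : lmodType H) (a : W -> M).
Hypothesis hM : involution_module S star u T a.
Variable barM : {additive M -> M}.
Hypothesis hbarM : module_bar a barH barM.
Variables (uM : lmodType uA) (j : {additive M -> uM}).
Hypothesis huM : scalar_extension iota (@bscale A H M) j.
Variable baruM : {additive uM -> uM}.
Hypothesis hbaruM : extended_bar v j barM baruM.
Variable P : W -> W -> {poly int}.
Hypothesis hP : kl_family S star u v iota a j baruM P.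

Local Notation len := (len S).
Local Notation lc := (lcoef huA).
Local Notation bar := (lbar huA).
Local Notation KL := (kl_element S star u v iota a j P).

Let vU : v \is a GRing.unit. Proof. exact: laurent_unit huA. Qed.

(** The bar operator is prescribed on monomial multiples; additivity over the expansion of [r] gives
    semilinearity. *)
Lemma extended_bar_scale r m : baruM (r *: j m) = bar r *: j (barM m).
Proof.
have [L uL r0] := lcoef_support huA r.
rewrite (lbar_expand uL r0) {1}(lcoef_expand uL r0) !scaler_suml raddf_sum.
apply: eq_bigr => n _.
by rewrite -!scalerMzl raddfMz hbaruM.
Qed.

(** The coefficient of [a_y] in [A_w]. *)
Definition klc w y : uA :=
  if `[< Istar star y /\ bruhat_le S y w >]
  then v ^- len w * iota ((map_poly intr (P y w)).[u]) else 0.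

Definition kl_supp w : seq W := fset_set [set y | Istar star y /\ bruhat_le S y w].

Lemma kl_supp_finite w : finite_set [set y | Istar star y /\ bruhat_le S y w].
Proof. by apply: sub_finite_set (bruhat_finite hW w) => y []. Qed.

Lemma kl_suppP w y : reflect (Istar star y /\ bruhat_le S y w) (y \in kl_supp w).
Proof.
rewrite /kl_supp in_fset_set; last exact: kl_supp_finite.
by apply: (iffP idP) => [/set_mem|h]; last exact/mem_set.
Qed.

Lemma klc_supp w y : y \notin kl_supp w -> klc w y = 0.
Proof. by rewrite /klc => /kl_suppP; case: asboolP. Qed.

Lemma kl_elementE w : KL w = \sum_(y <- kl_supp w) klc w y *: j (a y).
Proof.
rewrite /kl_element fsbig_finite; last exact: kl_supp_finite.
rewrite scaler_sumr; apply: eq_big_seq => y /kl_suppP yw.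
by rewrite scalerA /klc asboolT.
Qed.

Lemma klc_self w : Istar star w -> klc w w = v ^ (- (len w)%:Z).
Proof.
move=> Iw; rewrite /klc asboolT; last by split=> //; exact: bruhat_refl.
have [_ -> _] := hP Iw.
by rewrite map_polyC /= hornerC !rmorph1 mulr1 -exprnN.
Qed.

(** As [u = v^2], the polynomial has [v]-degree at most [l(w) - l(y) - 1], and the factor
    [v^(-l(w))] shifts this below [-l(y)]. *)
Lemma klc_deg w y n : Istar star w -> y <> w -> - (len y)%:Z <= n ->
  lc (klc w y) n = 0.
Proof.
move=> Iw yw len_n; rewrite /klc; case: asboolP => [[Iy le]|_]; last exact: lcoef0.
have [_ _ /(_ y Iy (conj le yw)) deg] := hP Iw.
rewrite (@horner_coef_wide _ (size (P y w))) ?size_poly_le //; last exact: size_poly.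
rewrite rmorph_sum mulr_sumr lcoef_sum big1 // => i _.
rewrite coef_map_id0 //= rmorphM rmorph_int rmorphXn hiota -exprM mulrzl.
rewrite exprnN exprnP mulrzAr lcoefMz -exprzDr // lcoefX.
case: eqP => [E|]; last by rewrite mulr0.
exfalso; have := ltn_ord i; move: deg len_n; rewrite -E.
move: (size _) (nat_of_ord i) => p q h1 h2 h3; lia.
Qed.

Section Coefficients.
Variable co : W -> {linear uM -> uA^o}.
Hypothesis coE : forall z y, Istar star y -> co z (j (a y)) = (y == z)%:R.

Lemma coZ z r X : co z (r *: X) = r * co z X :> uA.
Proof. by rewrite linearZ. Qed.

Lemma co_kl w z : co z (KL w) = klc w z.
Proof.
rewrite kl_elementE linear_sum /=.
rewrite -[RHS](@sum_pick _ _ (kl_supp w) (klc w)) //; last 1 first.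
- by move=> y; exact: klc_supp.
- apply: eq_big_seq => y /kl_suppP[Iy _].
  by rewrite coZ coE.
- exact: fset_uniq.
Qed.

Lemma lbarX n : bar (v ^ n) = v ^ (- n).
Proof.
apply/eqP; rewrite -subr_eq0; apply/eqP; apply: (lcoef_eq0 (hv := huA)) => m.
by rewrite lcoefB lcoef_lbar !lcoefX eqr_oppLR subrr.
Qed.

Lemma lbar0 : bar 0 = 0.
Proof.
by apply: (lcoef_eq0 (hv := huA)) => m; rewrite lcoef_lbar lcoef0.
Qed.

(* The bar operator is triangular because the [A_w] are bar invariant and
   unitriangular in the basis [v^(-l(w)) a_w]. *)
Lemma bar_triangular w z : Istar star w -> (len w <= len z)%N ->
  co z (baruM (j (a w))) = (w == z)%:R * v ^ (- (len w).*2%:Z).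
Proof.
have [n] := ubnP (len w); elim: n w z => // n IH w z hn Iw wz.
have [inv _ _] := hP Iw.
have := congr1 (co z) inv; rewrite co_kl kl_elementE raddf_sum linear_sum /=.
rewrite (bigD1_seq w) /=; last exact: fset_uniq; last first.
  by apply/kl_suppP; split=> //; exact: bruhat_refl.
have bj y : baruM (j (a y)) = j (barM (a y)).
  by have := hbaruM 0 (a y); rewrite oppr0 expr0z !scale1r.
(* The terms [y < w] satisfy [l(y) < l(w) <= l(z)], so by induction they contribute nothing at
   [z]. *)
rewrite big1_seq ?addr0 => [|y /andP[yw /kl_suppP[Iy le]]]; last first.
  have [E|lt] := bruhat_len le; first by rewrite E eqxx in yw.
  rewrite extended_bar_scale coZ -bj IH //.
  - have -> : (y == z) = false; last by rewrite mul0r mulr0.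
    by apply/eqP => E; move: lt; rewrite E ltnNge wz.
  - by move: hn lt; lia.
  - exact: leq_trans (ltnW lt) wz.
rewrite extended_bar_scale coZ -bj klc_self // lbarX opprK.
set c := co z _ => E.
have {E} -> : c = v ^ (- (len w)%:Z) * klc w z.
  by rewrite -E mulrA -exprzDr // addNr expr0z mul1r.
have [<-|ne] := eqVneq w z.
  by rewrite klc_self // mul1r -exprzDr //; congr (v ^ _); lia.
rewrite mul0r /klc; case: asboolP => [[Iz le]|]; last by rewrite mulr0.
have [E|lt] := bruhat_len le; first by rewrite E eqxx in ne.
by rewrite ltnNge wz in lt.
Qed.

(** The universal property of [uM] gives the coordinates [co z], but not directly
    that the [j (a w)] span it. *)
Definition expands (X : uM) : Prop := exists L : seq W,
  [/\ uniq L, (forall z, z \in L -> Istar star z),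
      (forall z, z \notin L -> co z X = 0)
    & X = \sum_(z <- L) co z X *: j (a z)].

Lemma expands_widen X (L : seq W) : expands X -> uniq L ->
  (forall z, z \in L -> Istar star z) -> (forall z, z \notin L -> co z X = 0) ->
  X = \sum_(z <- L) co z X *: j (a z).
Proof.
move=> [L' [uL' LI' c0' XE]] uL LI c0; rewrite {1}XE.
(* Both lists contain the support, so both sums agree with the one over the union. *)
have E (L1 L2 : seq W) : uniq L1 -> uniq L2 ->
    (forall z, z \notin L1 -> co z X = 0) -> (forall z, z \notin L2 -> co z X = 0) ->
  \sum_(z <- L1) co z X *: j (a z) = \sum_(z <- undup (L1 ++ L2)) co z X *: j (a z).
  move=> u1 u2 c1 c2; rewrite [RHS](bigID (mem L1)) /= [X in _ + X]big1 ?addr0; last first.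
    by move=> z /c1->; rewrite scale0r.
  rewrite -[RHS]big_filter; apply: perm_big; apply: uniq_perm => //.
    exact/filter_uniq/undup_uniq.
  move=> z; rewrite mem_filter mem_undup mem_cat.
  by case: (z \in L1).
rewrite (E L' L) // (E L L') //; apply: perm_big; apply: uniq_perm; rewrite ?undup_uniq //.
by move=> z; rewrite !mem_undup !mem_cat orbC.
Qed.

Lemma expandsD X Y : expands X -> expands Y -> expands (X + Y).
Proof.
move=> eX eY; have [Lx [ux xI x0 _]] := eX; have [Ly [uy yI y0 _]] := eY.
have uL := undup_uniq (Lx ++ Ly).
have LI z : z \in undup (Lx ++ Ly) -> Istar star z.
  by rewrite mem_undup mem_cat => /orP[/xI|/yI].
have Lx0 z : z \notin undup (Lx ++ Ly) -> co z X = 0.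
  by rewrite mem_undup mem_cat negb_or => /andP[/x0].
have Ly0 z : z \notin undup (Lx ++ Ly) -> co z Y = 0.
  by rewrite mem_undup mem_cat negb_or => /andP[_ /y0].
exists (undup (Lx ++ Ly)); split=> // [z zL|].
  by rewrite linearD /= Lx0 // Ly0 // addr0.
rewrite {1}(expands_widen eX uL LI Lx0) {1}(expands_widen eY uL LI Ly0) -big_split.
by apply: eq_bigr => z _; rewrite linearD /= scalerDl.
Qed.

Lemma expandsZ r X : expands X -> expands (r *: X).
Proof.
move=> [L [uL LI x0 XE]]; exists L; split=> // [z zL|].
  by rewrite coZ x0 // mulr0.
rewrite {1}XE scaler_sumr; apply: eq_bigr => z _.
by rewrite coZ scalerA.
Qed.

Lemma expands_basis w : Istar star w -> expands (j (a w)).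
Proof.
move=> Iw; exists [:: w]; split=> // [z|z|]; rewrite ?inE.
- by move/eqP->.
- by rewrite coE // eq_sym => /negbTE->.
- by rewrite big_seq1 coE // eqxx scale1r.
Qed.

Lemma expands_sum (I : eqType) (L : seq I) (F : I -> uM) :
  (forall i, i \in L -> expands (F i)) -> expands (\sum_(i <- L) F i).
Proof.
elim: L => [_|i L IH hL].
  by rewrite big_nil; exists [::]; split=> //; rewrite ?big_nil // => z _; rewrite linear0.
rewrite big_cons; apply: expandsD; first by apply: hL; rewrite inE eqxx.
by apply: IH => k kL; apply: hL; rewrite inE kL orbT.
Qed.

(** By triangularity, only the term of [a_z] in [X] contributes to the coefficient of [a_z] in
    [bar X]. Comparing with [v^k X] gives a symmetry about the degree [-k/2 - l(z)]. *)
Lemma bar_top X z k : expands X -> baruM X = v ^ k *: X ->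
  (forall y, Istar star y -> (len z < len y)%N -> co y X = 0) ->
  forall n, lc (co z X) n = lc (co z X) (- n - k - (len z).*2%:Z).
Proof.
move=> [L [uL LI c0 XE]] inv top n.
have E : co z (baruM X) = bar (co z X) * v ^ (- (len z).*2%:Z).
  rewrite {1}XE raddf_sum linear_sum /=.
  rewrite -[RHS](@sum_pick _ _ L (fun y => bar (co y X) * v ^ (- (len y).*2%:Z))) //; last first.
    move=> y /c0 X0; have {}X0 : co y X = 0 :> uA by exact: X0.
    by rewrite X0 lbar0 mul0r.
  apply: eq_big_seq => y yL; rewrite extended_bar_scale coZ.
  have [yz|zy] := leqP (len y) (len z); last first.
    have X0 : co y X = 0 :> uA by exact: top (LI y yL) zy.
    by rewrite X0 lbar0 !mul0r.
  rewrite -mulrA; congr (_ * _).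
  have <- : baruM (j (a y)) = j (barM (a y)).
    by have := hbaruM 0 (a y); rewrite oppr0 expr0z !scale1r.
  by rewrite (bar_triangular (LI y yL) yz) mulrC.
move: E; rewrite inv coZ => /(congr1 (fun r => lc r (n + k))).
rewrite [X in _ = lc X _]mulrC !lcoefXM lcoef_lbar addrK => ->.
by congr (lc _ _); rewrite opprK !opprD.
Qed.

(** * The operator [T_s - u^2] and descents of [w] *)

Section Descent.
Variable s : W.
Hypothesis Ss : S s.

Local Notation up := (fun y => (len y < len (s * y)%g)%N).
Local Notation cm := (fun y : W => (s * y == y * star s)%g).

(** Applied to either element of a pair linked by [sact s], [T_s - u^2] gives, up to sign,
    [sact_top] times the longer basis element minus [sact_bot] times the shorter one. *)
Definition sact_top (y : W) : uA := if cm y then v ^+ 2 + 1 else 1.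
Definition sact_bot (y : W) : uA := if cm y then v ^+ 4 - v ^+ 2 else v ^+ 4.
Definition hecke_kill : H := T s - (u ^+ 2)%:A.

Let uU : u \is a GRing.unit. Proof. by case: hA. Qed.

(** The quadratic relation gives [T_s^-1 = u^-2 (T_s + 1 - u^2)]; subtracting [u^-2] leaves
    [u^-2 (T_s - u^2)]. *)
Lemma bar_hecke_kill : barH hecke_kill = u ^- 2 *: hecke_kill.
Proof.
have [_ T1 _ /(_ s Ss) quad] := hH; have [_ bT] := hbarH.
have u2U : u ^+ 2 \is a GRing.unit by rewrite unitrX.
have bTs : barH (T s) = (T s)^-1.
  by have := bT 0 s; rewrite oppr0 expr0z !scale1r (simpleV hW).
have bu : barH (u ^+ 2)%:A = (u ^- 2)%:A.
  have := bT 2 1%g; rewrite T1 invg1 T1 invr1.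
  by rewrite -exprnP -exprnN.
pose h := u ^- 2 *: (T s + 1 - (u ^+ 2)%:A).
have hr : T s * h = 1.
  have {}quad : T s * (T s + 1 - (u ^+ 2)%:A) = (u ^+ 2)%:A.
    apply/eqP; rewrite -subr_eq0 -quad; apply/eqP.
    by rewrite [T s + 1 - _]addrAC mulrDr mulr1 mulrDl mul1r addrA.
  by rewrite /h -scalerAr quad scalerA mulVr // scale1r.
have hl : h * T s = 1.
  rewrite -hr -scalerAl -scalerAr; congr (_ *: _).
  by rewrite mulrBl mulrDl mulrBr mulrDr mulr1 mul1r -scalerAl -scalerAr mul1r mulr1.
have E : (T s)^-1 = h.
  have TU : T s \is a GRing.unit by apply/unitrP; exists h.
  by apply: (mulrI TU); rewrite mulrV.
rewrite /hecke_kill rmorphB bTs bu E -scalerBr; congr (_ *: _).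
by rewrite addrAC addrK.
Qed.

Variable t : {linear uM -> uM}.
Hypothesis tE : forall m, t (j m) = j (hecke_kill *: m).

Lemma actZ r X : t (r *: X) = r *: t X.
Proof. by rewrite linearZ. Qed.

Lemma bar_kill w : Istar star w -> baruM (t (KL w)) = v ^ (- 4) *: t (KL w).
Proof.
move=> Iw; have [{2}<- _ _] := hP Iw.
rewrite kl_elementE !(raddf_sum t) !(raddf_sum baruM) (raddf_sum t) scaler_sumr.
apply: eq_bigr => y _ /=; rewrite !actZ tE !extended_bar_scale !actZ tE.
have [bM _] := hbarM.
rewrite bM bar_hecke_kill.
have -> : (u ^- 2 *: hecke_kill) *: barM (a y) = bscale (u ^- 2) (hecke_kill *: barM (a y)).
  by rewrite /bscale scalerA -scalerAl mul1r.
rewrite (ext_scale huM) !scalerA mulrC; congr (_ * _ *: _).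
by rewrite rmorphV ?unitrX // rmorphXn hiota -exprM -exprnN.
Qed.

Lemma downE y : (len (s * y)%g < len y)%N = ~~ up y.
Proof.
rewrite -leqNgt [RHS]leq_eqVlt.
by rewrite (negbTE (reflection_len_neq hW y (reflection_simple Ss))).
Qed.

Lemma kill_basis y : Istar star y ->
  t (j (a y)) = (if up y then sact_top y else sact_bot y) *: j (a (sact star s y))
              - (if up y then sact_bot y else sact_top y) *: j (a y).
Proof.
move=> Iy; have [_ /(_ s y Ss Iy)[h1 h2 h3 h4]] := hM.
have js c m : j (bscale c m) = iota c *: j m by exact: ext_scale.
rewrite tE scalerBl raddfB -/(bscale (u ^+ 2) (a y)) js /sact /sact_top /sact_bot.
have comb c1 c2 c3 (p q : uM) : c1 *: p + c2 *: q - c3 *: p = c2 *: q - (c3 - c1) *: p.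
  by rewrite scalerBl opprB addrCA addrA.
have E4 : v ^+ 4 = iota u ^+ 2 by rewrite hiota -exprM.
rewrite E4 -hiota rmorphXn /=.
case: (ltnP (len y) (len (s * y)%g)) => [yu|]; last first.
  rewrite leq_eqVlt (negbTE (reflection_len_neq hW y (reflection_simple Ss))) /= => yd.
  have lt : bruhat_lt S (s * y)%g y.
    by have := bruhat_simple Ss (w := (s * y)%g); rewrite (simpleK hW) //; apply.
  case: ifP => [/eqP|/eqP] c.
    rewrite h2 // raddfD !js comb !(rmorphB, rmorph1, rmorphXn) /=.
    by congr (_ - _ *: _); ring.
  rewrite h4 // raddfD !js comb !(rmorphB, rmorph1, rmorphXn) /=.
  by congr (_ - _ *: _); ring.
have lt := bruhat_simple Ss yu.
case: ifP => [/eqP|/eqP] c.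
  by rewrite h1 // raddfD !js comb !(rmorphD, rmorph1).
by rewrite h3 // scale1r.
Qed.

Lemma sact_upE y : Istar star y -> up (sact star s y) = ~~ up y.
Proof.
move=> Iy; have [yu|yd] := boolP (len y < len (s * y)%g)%N.
  by apply/negbTE; rewrite -downE; exact: (sact_up_down hW hstar).
by apply: (sact_down_up hW hstar) => //; rewrite downE.
Qed.

(** Only [a_z] and its neighbour produce [a_z], with opposite coefficients, so the difference of
    their coefficients in [A_w] factors out. *)
Lemma co_kill w z : Istar star z ->
  co z (t (KL w)) = (if up z then sact_bot z else sact_top z)
                    * (klc w (sact star s z) - klc w z).
Proof.
move=> Iz; rewrite kl_elementE !linear_sum /=.
pose f y := klc w y * (if up y then sact_top y else sact_bot y).
pose g y := klc w y * (if up y then sact_bot y else sact_top y).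
have Lu : uniq (kl_supp w) by exact: fset_uniq.
transitivity (\sum_(y <- kl_supp w) (f y * (y == sact star s z)%:R - g y * (y == z)%:R)).
  apply: eq_big_seq => y /kl_suppP[Iy _].
  rewrite actZ coZ kill_basis // linearB /= !coZ !coE //; last exact: (sact_Istar hW hstar Ss Iy).
  have -> : (sact star s y == z) = (y == sact star s z).
    by apply/eqP/eqP => [<-|->]; rewrite (sactK hW hstar).
  by rewrite mulrBr !mulrA.
rewrite sumrB !sum_pick // => [|y /klc_supp|y /klc_supp]; rewrite /f /g ?mul0r //; last 2 first.
- by move=> ->; rewrite mul0r.
- by move=> ->; rewrite mul0r.
rewrite sact_upE // /sact_top /sact_bot (sact_comm hW hstar) //.
by case: (up z); case: (cm z) => /=; ring.
Qed.

(** Division by [v^2 + 1] from below: up to degree [k], each coefficient of [r] is minus the one two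
    degrees lower, and these vanish far enough down. *)
Lemma lcoef_one_plus r k : (forall n, n <= k -> lc ((v ^+ 2 + 1) * r) n = 0) ->
  forall n, n <= k -> lc r n = 0.
Proof.
move=> h; have [N rN] := lcoef_lower huA r.
suff H1 (i : nat) n : n <= k -> n < N + i%:Z -> lc r n = 0.
  by move=> n nk; apply: (H1 `|n - N|.+1) => //; lia.
elim: i n => [|i IH] n nk; first by rewrite addr0; exact: rN.
move=> ni; have := h n nk; rewrite mulrDl mul1r lcoefD exprnP lcoefXM.
rewrite IH ?add0r //; lia.
Qed.

Lemma klc_descent w y : Istar star w -> (len (s * w)%g < len w)%N ->
  Istar star y -> up y -> klc w (sact star s y) = klc w y.
Proof.
move=> Iw wd.
pose Y := t (KL w).
pose d z := klc w (sact star s z) - klc w z.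
have inv : baruM Y = v ^ (- 4) *: Y by exact: bar_kill.
have eY : expands Y.
  rewrite /Y kl_elementE linear_sum; apply: expands_sum => z /kl_suppP[Iz _].
  rewrite actZ; apply: expandsZ; rewrite kill_basis // -scaleNr.
  by apply: expandsD; apply: expandsZ; apply: expands_basis => //; exact: (sact_Istar hW hstar Ss Iz).
(* [v^2 + 1] is not a zero divisor, so [sact_top] can be cancelled. *)
have top0 z : Istar star z -> sact_top z * d z = 0 -> d z = 0.
  rewrite /sact_top; case: ifP => _ Iz; last by rewrite mul1r.
  move=> E; apply: (lcoef_eq0 (hv := huA)) => n.
  by apply: (@lcoef_one_plus (d z) n) => // m _; rewrite E lcoef0.
have dV z : d (sact star s z) = - d z by rewrite /d (sactK hW hstar) // opprB.
(* The factor at the ascent [y] is [sact_bot]; passing to its neighbour, a descent, gives the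
   cancellable [sact_top]. *)
suff Y0 z : Istar star z -> co z Y = 0 :> uA.
  move=> Iy yu; apply/eqP; rewrite -subr_eq0 -/(d y) -[d y]opprK -dV oppr_eq0.
  have Isy := sact_Istar hW hstar Ss Iy.
  apply/eqP/top0 => //; have := Y0 _ Isy.
  by rewrite co_kill // sact_upE // yu.
move: z; have [L [_ _ L0 _]] := eY.
have [N NL] : exists N : nat, forall z, z \in L -> (len z <= N)%N.
  by exists (\max_(z <- L) len z)%N => z zL; exact: leq_bigmax_seq.
(* Downward induction on [l(z)]: above the maximal length [N] in [L] the coefficients vanish, and
   [i] measures how far below [z] may lie. *)
suff H2 i z : Istar star z -> (N < len z + i)%N -> co z Y = 0 :> uA.
  by move=> z Iz; apply: (H2 N.+1) => //; rewrite addnS ltnS leq_addl.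
move: i z; elim=> [|i IH] z Iz.
  rewrite addn0 => Nz; apply: L0; apply/negP => /NL.
  by rewrite leqNgt Nz.
move=> Nz; have topz x : Istar star x -> (len z < len x)%N -> co x Y = 0.
  by move=> Ix lt; apply: IH => //; lia.
have Isz := sact_Istar hW hstar Ss Iz.
(* If [s] is an ascent of [z], the neighbour is longer, so its coefficient in [Y] is already zero;
   the common difference [d] then vanishes. *)
case: (boolP (up z)) => zu.
  have E := sact_len_up hW hstar Ss Iz zu.
  have : co (sact star s z) Y = 0 :> uA.
    by apply: topz => //; rewrite E; case: ifP => _; rewrite ?addn1 ?addn2.
  rewrite co_kill // sact_upE // zu => /(top0 _ Isz); rewrite dV => /eqP.
  by rewrite oppr_eq0 /Y co_kill // zu -/(d z) => /eqP->; rewrite mulr0.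
have sym := bar_top eY inv topz.
have cE : co z Y = sact_top z * d z by rewrite /Y co_kill // (negbTE zu).
have zd : (len (s * z)%g < len z)%N by rewrite downE.
have lz := sact_len_down hW hstar Ss Iz zd.
(* The neighbour has [s] as an ascent and [w] does not, so the strict bound [klc_deg] applies to it.
   Only [z] itself may equal [w], which allows the degree [-l(z)]. *)
have sw : sact star s z <> w.
  by move=> E; have := sact_upE Iz; rewrite E zu => wu; move: wd; rewrite downE wu.
have dz n : - (len z)%:Z < n -> lc (klc w z) n = 0.
  move=> ln; have [E|/eqP zw] := eqVneq z w; last by rewrite klc_deg // ltW.
  by rewrite E in ln *; rewrite klc_self // lcoefX (lt_eqF ln).
have dsz n : - (len (sact star s z))%:Z <= n -> lc (klc w (sact star s z)) n = 0.
  exact: klc_deg.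
apply: (lcoef_eq0 (hv := huA)) => n.
move: cE sym; rewrite /sact_top; move: lz; case: ifP => _ lz -> sym.
  (* Here [d z] has degree at most [-l(z)], hence [(v^2 + 1) d z] at most [2 - l(z)]. Degrees
     [<= -l(z)] reflect to [>= 4 - l(z)], so the product vanishes there and so does [d z]. *)
  suff -> : d z = 0 by rewrite mulr0 lcoef0.
  have dd m : - (len z)%:Z < m -> lc (d z) m = 0.
    by move=> lm; rewrite lcoefB dz // dsz ?subr0 //; lia.
  apply: (lcoef_eq0 (hv := huA)) => m.
  have [/dd//|ml] := ltP (- (len z)%:Z) m.
  apply: (@lcoef_one_plus _ (- (len z)%:Z)) => // p pl.
  rewrite sym mulrDl mul1r lcoefD exprnP lcoefXM !dd ?addr0 //; lia.
(* The neighbour is now shorter by two, so [d z] lives strictly below the centre of symmetry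
   [2 - l(z)]. *)
have dd m : 2 - (len z)%:Z <= m -> lc (d z) m = 0.
  by move=> lm; rewrite lcoefB dz ?dsz ?subr0 //; lia.
rewrite mul1r in sym *.
have [/dd//|ml] := leP (2 - (len z)%:Z) n.
by rewrite sym dd //; lia.
Qed.
End Descent.
End Coefficients.

End KazhdanLusztig.

(** The list is a union of the sets of twisted involutions of double cosets, on each of which [f] is
    constant. Removing one coset at a time splits off a multiple of some [a_Om]. *)
Lemma MK_coset_sum (W : groupType) (S : set W) (star : W -> W) (K : set W)
  (M : zmodType) (a : W -> M) (B : comUnitRingType) (N : lmodType B)
  (j : {additive M -> N}) (f : W -> B) (L : seq W) :
  diagram_involution S star -> finite_set (gen K) ->
  uniq L -> (forall y, y \in L -> Istar star y) ->
  (forall y z, y \in L -> Istar star z -> dcoset star K y z ->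
     z \in L /\ f z = f y) ->
  MK star K a j (\sum_(y <- L) f y *: j (a y)).
Proof.
move=> hstar hK; have [n] := ubnP (size L).
elim: n L => // n IH [|y L1] hn uL LI Lf.
  by rewrite big_nil; exists 0%N, (fun _ => 0), (fun _ => 0); split=> [[]//|]; rewrite big_ord0.
set L := y :: L1 in hn uL LI Lf *.
have yL : y \in L by rewrite inE eqxx.
pose O := dcoset star K y.
have Oy : O y by exact: dcoset_refl.
have fO : finite_set (Istar star `&` O).
  by apply: sub_finite_set (dcoset_finite hstar hK y) => z [].
rewrite (bigID (fun z => `[< O z >])) /=.
have -> : \sum_(z <- L | `[< O z >]) f z *: j (a z) = f y *: j (a_coset star a O).
  rewrite /a_coset fsbig_finite // raddf_sum scaler_sumr -big_filter.
  rewrite [LHS](perm_big (fset_set (Istar star `&` O))); last first.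
    apply: uniq_perm; [exact: filter_uniq|exact: fset_uniq|move=> z].
    rewrite mem_filter in_fset_set //.
    apply/andP/idP => [[/asboolP Oz zL]|/set_mem[Iz Oz]].
      by apply/mem_set; split=> //; exact: LI.
    by split; [exact/asboolP|case: (Lf y z)].
  apply: eq_big_seq => z; rewrite in_fset_set // => /set_mem[Iz Oz].
  by have [_ ->] := Lf y z yL Iz Oz.
apply: span_scaleD.
  by exists O => //; exact: (dcoset_IstarK hstar K (LI y yL)).
rewrite -big_filter; apply: IH.
- rewrite ltnS in hn; rewrite size_filter; apply: leq_trans hn.
  rewrite -(count_predC (fun z => `[< O z >]) L) addnC -[X in (X < _)%N]addn0 ltn_add2l.
  by rewrite -has_count; apply/hasP; exists y => //; exact/asboolP.
- exact: filter_uniq.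
- by move=> z; rewrite mem_filter => /andP[_ /LI].
- move=> x z; rewrite mem_filter => /andP[nOx xL] Iz xz.
  have [zL fz] := Lf x z xL Iz xz; split=> //; rewrite mem_filter zL andbT.
  (* Double cosets are disjoint or equal, so the remaining list is still closed under them. *)
  apply: contra nOx => /asboolP Oz; apply/asboolP.
  rewrite /O (double_cosetE (dcoset_double star K y) Oz).
  rewrite -(double_cosetE (dcoset_double star K x) xz).
  exact: dcoset_refl.
Qed.

Theorem mainTheorem6
  (W : groupType) (S : set W) (star : W -> W)
  (hW : coxeter_system S) (hstar : diagram_involution S star)
  (A uA : comUnitRingType) (u : A) (v : uA) (iota : {rmorphism A -> uA})
  (hA : laurent_ring u) (huA : laurent_ring v) (hiota : iota u = v ^+ 2)
  (H : unitAlgType A) (T : W -> H) (hH : hecke_algebra S u T)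
  (barH : {rmorphism H -> H}) (hbarH : hecke_bar u T barH)
  (M : lmodType H) (a : W -> M) (hM : involution_module S star u T a)
  (barM : {additive M -> M}) (hbarM : module_bar a barH barM)
  (uM : lmodType uA) (j : {additive M -> uM})
  (huM : scalar_extension iota (@bscale A H M) j)
  (baruM : {additive uM -> uM}) (hbaruM : extended_bar v j barM baruM)
  (P : W -> W -> {poly int})
  (hP : kl_family S star u v iota a j baruM P)
  (K : set W) (hKS : K `<=` S) (hK : finite_set (gen K))
  (Om : set W) (hOm : IstarK star K Om) :
  MK star K a j (kl_element S star u v iota a j P (dmax S Om)).
Proof.
set d := dmax S Om.
have Id : Istar star d by exact: (dmax_Istar hW hstar hKS hK hOm).
have [co coE] := ext_coord_exists huM (proj1 hM).
have step s w : K s -> Istar star w -> (len S w < len S (s * w)%g)%N ->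
    klc S star u v iota P d (sact star s w) = klc S star u v iota P d w.
  move=> Ks; have Ss := hKS _ Ks.
  have [t tE] := ext_act_exists huM (hecke_kill u T s).
  apply: (klc_descent hW hstar hA huA hiota hH hbarH hM hbarM huM hbaruM hP coE Ss tE) => //.
  exact: (dmax_descentL hW hstar hKS hK (proj1 hOm) Ks).
have cst x y z : Istar star y -> Istar star z -> dcoset star K x y -> dcoset star K x z ->
    klc S star u v iota P d y = klc S star u v iota P d z.
  move=> Iy Iz xy xz.
  have C := dmax_const hW hstar hKS hK step (dcoset_double star K x).
  by rewrite (C y) // (C z).
rewrite (kl_elementE star hW).
(* Dropping zero coefficients makes the list closed under double cosets: constancy carries
   nonvanishing from [y] to [z], and a nonzero coefficient puts [z] in the support. *)
set L := [seq y <- kl_supp S star d | klc S star u v iota P d y != 0].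
have -> : \sum_(y <- kl_supp S star d) klc S star u v iota P d y *: j (a y)
        = \sum_(y <- L) klc S star u v iota P d y *: j (a y).
  rewrite big_filter [RHS]big_mkcond; apply: eq_bigr => y _.
  by case: eqP => // ->; rewrite scale0r.
apply: (MK_coset_sum a j hstar hK).
- by apply: filter_uniq; exact: fset_uniq.
- by move=> y; rewrite mem_filter => /andP[_ /(kl_suppP star hW)[]].
- move=> y z; rewrite mem_filter => /andP[y0 /(kl_suppP star hW)[Iy _]] Iz yz.
  have E := cst y z y Iz Iy yz (dcoset_refl star K y).
  split=> //; rewrite mem_filter E y0 /=.
  by apply: contraNT y0 => /(klc_supp hW); rewrite -E => ->.
Qed.
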